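(* Let $\varphi:\overline{\mathbb{B}^m}\times I\to\mathbb{R}^m$ be a $C^1$ map, where $I\subset\mathbb{R}$ is an interval, let $\mathcal{S}(t):=\varphi(\partial\mathbb{B}^m,t)$ be the corresponding moving cycle, and let $f:\mathbb{R}^m\times I\to\mathbb{R}$ be a $C^1$ scalar field. Then $$\frac{d}{dt}\left(\int_{\mathbb{B}^m}f(\varphi(\mathbf{x},t),t)\,J_\varphi(t)\,d\mathbf{x}\right)=\int_{\mathbb{B}^m}\partial_tf\,J_\varphi(t)\,d\mathbf{x}+\oint_{\mathcal{S}(t)}f(\mathbf{p},t)\,\partial_t\varphi\cdot\mathbf{n}_{\mathcal{S}}\,d\mathbf{p},$$ where $J_\varphi(t)$ is the determinant of the spatial Jacobian matrix of $\varphi(\cdot,t)$ at $\mathbf{x}$, $\partial_tf$ in the first integral on the right is evaluated at $(\varphi(\mathbf{x},t),t)$, and $\mathbf{n}_{\mathcal{S}}$ is the outward normal vector of the cycle $\mathcal{S}(t)$.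
   Context: $m\ge2$ and $\mathbb{B}^m:=(0,1)^m$ is the open $m$-cube; $\varphi(\cdot,t)$ need not be injective. A wedge product of $m$ vectors of $\mathbb{R}^m$ is identified with the determinant of the matrix having these vectors as its columns in order. Outward normal of a cycle $\psi=\varphi(\cdot,t)|_{\partial\mathbb{B}^m}$: at a point $\mathbf{z}\in\partial\mathbb{B}^m$ with $z_i=s$, $s\in\{0,1\}$, and all other coordinates in $(0,1)$, it is the unit vector $\mathbf{n}_{\mathcal{S}}(\mathbf{z})$ orthogonal to $\partial_{z_k}\psi(\mathbf{z})$ for all $k\neq i$ such that $\left(\bigwedge_{k=1}^{i-1}\partial_{z_k}\psi\right)\wedge\mathbf{n}_{\mathcal{S}}\wedge\left(\bigwedge_{k=i+1}^{m}\partial_{z_k}\psi\right)$ is $\le0$ if $s=0$ and $\ge0$ if $s=1$ (equality occurs only at singular points, which do not contribute to integrals). The integral over the cycle is parametric: $\oint_{\mathcal{S}(t)}f\,\partial_t\varphi\cdot\mathbf{n}_{\mathcal{S}}\,d\mathbf{p}$ is the sum over the $2m$ open faces of $\partial\mathbb{B}^m$ of $\int f(\varphi(\mathbf{z},t),t)\,\partial_t\varphi(\mathbf{z},t)\cdot\mathbf{n}_{\mathcal{S}}(\mathbf{z})\,dA(\mathbf{z})$, with $dA$ the $(m-1)$-dimensional area element induced by $\varphi(\cdot,t)$ on that face (self-overlaps are counted with multiplicity). *)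

(* Defs.v *)
From HB Require Import structures.
From mathcomp Require Import all_boot all_order all_algebra.
From mathcomp Require Import all_classical all_reals all_analysis.

Set Implicit Arguments.
Unset Strict Implicit.
Unset Printing Implicit Defensive.

Import Order.TTheory GRing.Theory Num.Theory.
Import numFieldNormedType.Exports.

Local Open Scope classical_set_scope.
Local Open Scope ring_scope.

Section lebesgue_tuple.
Context {R : realType}.
Local Open Scope ereal_scope.

Let T : measurableType _ := measurableTypeR R.

Let lambda : {sigma_finite_measure set T -> \bar R} := @lebesgue_measure R.

Definition cons_pair n (xy : T * n.-tuple T) : n.+1.-tuple T :=
  [tuple of xy.1 :: xy.2].

Lemma measurable_cons_pair n :
  measurable_fun [set: T * n.-tuple T] (@cons_pair n).
Proof. by apply: measurable_cons. Qed.

Section step.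
Variables (n : nat) (mu : {sigma_finite_measure set (n.-tuple T) -> \bar R}).

Definition lebesgue_cons : set (n.+1.-tuple T) -> \bar R :=
  pushforward (lambda \x mu) (@cons_pair n).

Let lebesgue_cons0 : lebesgue_cons set0 = 0.
Proof. by rewrite /lebesgue_cons /pushforward preimage_set0 measure0. Qed.

Let lebesgue_cons_ge0 A : 0 <= lebesgue_cons A.
Proof. by rewrite /lebesgue_cons /pushforward; exact: measure_ge0. Qed.

Let measurable_preimage_cons (A : set (n.+1.-tuple T)) :
  measurable A -> measurable (@cons_pair n @^-1` A).
Proof.
by move=> mA; rewrite -[X in measurable X]setTI; exact: measurable_cons_pair.
Qed.

Let lebesgue_cons_sigma_additive : semi_sigma_additive lebesgue_cons.
Proof.
move=> F mF tF mUF; rewrite /lebesgue_cons /pushforward preimage_bigcup.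
apply: measure_semi_sigma_additive.
- by move=> k; exact: measurable_preimage_cons.
- apply/trivIsetP => /= i j _ _ ij; rewrite -preimage_setI.
  by move/trivIsetP : tF => /(_ _ _ _ _ ij) ->//; rewrite preimage_set0.
- by rewrite -preimage_bigcup; exact: measurable_preimage_cons.
Qed.

HB.instance Definition _ := isMeasure.Build _ _ _ lebesgue_cons
  lebesgue_cons0 lebesgue_cons_ge0 lebesgue_cons_sigma_additive.

Let lebesgue_cons_sigma_finite : sigma_finite setT lebesgue_cons.
Proof.
have /sigma_finiteP[F [TF ndF Foo]] := sigma_finiteT lambda.
have /sigma_finiteP[G [TG ndG Goo]] := sigma_finiteT mu.
pose g (x : n.+1.-tuple T) : T * n.-tuple T := (thead x, [tuple of behead x]).
have gK (p : T * n.-tuple T) : g (cons_pair p) = p.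
  by case: p => a b; congr pair; apply/val_inj.
have mg : measurable_fun setT g.
  apply/measurable_fun_pair; first exact: measurable_tnth.
  exact: measurable_behead.
exists (fun k => g @^-1` (F k `*` G k)).
  rewrite -preimage_bigcup; apply/esym; rewrite -subTset => z _ /=.
  have [i _ Fi] : (\bigcup_i F i) (g z).1 by rewrite -TF.
  have [j _ Gj] : (\bigcup_i G i) (g z).2 by rewrite -TG.
  exists (maxn i j) => //; split.
  - by move: Fi; exact/subsetPset/ndF/leq_maxl.
  - by move: Gj; exact/subsetPset/ndG/leq_maxr.
move=> k; have [mF Fk] := Foo k; have [mG Gk] := Goo k.
have mFG : measurable (F k `*` G k) by exact: measurableX.
split.
  by rewrite -[X in measurable X]setTI; exact: mg.
rewrite /lebesgue_cons /pushforward -comp_preimage.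
have -> : g \o @cons_pair n = id by apply/funext => p /=; rewrite gK.
by rewrite preimage_id product_measure1E// lte_mul_pinfty// ge0_fin_numE.
Qed.

HB.instance Definition _ := Measure_isSigmaFinite.Build _ _ _ lebesgue_cons
  lebesgue_cons_sigma_finite.

End step.

(* n-dimensional Lebesgue measure on the Borel sets of R^n, R^n being n.-tuple R:
   the image of lambda \x lebesgue_tuple n' by (x, y) |-> x :: y. *)
Fixpoint lebesgue_tuple n : {sigma_finite_measure set (n.-tuple T) -> \bar R} :=
  if n is n'.+1 return {sigma_finite_measure set (n.-tuple T) -> \bar R}
  then lebesgue_cons (lebesgue_tuple n')
  else \d_ [tuple].

End lebesgue_tuple.

Section defs.
Context {R : realType}.

(* Derivative relatively to I: the usual one at an interior point of I, one-sided
   at an endpoint of I. *)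
Definition is_deriv_in (V : normedModType R) (I : set R) (g : R -> V) (t : R)
    (d : V) : Prop :=
  (s - t)^-1 *: (g s - g t) @[s --> within I t^'] --> d.

Definition deriv_in (V : normedModType R) (I : set R) (g : R -> V) (t : R) : V :=
  lim ((s - t)^-1 *: (g s - g t) @[s --> within I t^']).

(* C^1 on a set D that need not be open: Frechet differentiable relatively to D
   with continuous differential.  V is finite-dimensional in all uses, so that
   linear maps are continuous and pointwise continuity of x |-> dF x is its
   continuity for the operator norm. *)
Definition C1_on (V W : normedModType R) (D : set V) (F : V -> W) : Prop :=
  exists dF : V -> {linear V -> W},
    (forall x, D x -> forall e, 0 < e ->
       \forall y \near within D (nbhs x),
         `|F y - F x - dF x (y - x)| <= e * `|y - x|) /\
    (forall v, {within D, continuous (fun x => dF x v)}).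

Definition open_cube n : set 'rV[R]_n := [set x | forall i, 0 < x 0 i < 1].

Definition closed_cube n : set 'rV[R]_n := [set x | forall i, 0 <= x 0 i <= 1].

Definition tuple_row n (y : n.-tuple (measurableTypeR R)) : 'rV[R]_n :=
  \row_i (tnth y i : R).

Definition int_cube n (g : 'rV[R]_n -> R) : R :=
  \int[lebesgue_tuple n]_(y in @tuple_row n @^-1` @open_cube n) g (tuple_row y).

(* `|_| on 'rV[R]_m is the max norm; the Euclidean structure is given by dot. *)
Definition dot m (u v : 'rV[R]_m) : R := \sum_i u 0 i * v 0 i.

Definition wedge m (v : 'I_m -> 'rV[R]_m) : R := \det (\matrix_(a, b) v b 0 a).

Definition partial m (psi : 'rV[R]_m -> 'rV[R]_m) (z : 'rV[R]_m) (k : 'I_m) :=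
  'D_(delta_mx 0 k) psi z.

(* The face {z_i = s} of the cube, s \in {0, 1}, parametrized by the other
   coordinates. *)
Definition face_point m (i : 'I_m) (s : bool) (y : 'rV[R]_m.-1) : 'rV[R]_m :=
  \row_k (if unlift i k is Some j then y 0 j else s%:R).

Definition area_element m (psi : 'rV[R]_m -> 'rV[R]_m) (i : 'I_m)
    (z : 'rV[R]_m) : R :=
  Num.sqrt (\det (\matrix_(j < m.-1, l < m.-1)
    dot (partial psi z (lift i j)) (partial psi z (lift i l)))).

Definition is_outward_normal m (psi : 'rV[R]_m -> 'rV[R]_m) (i : 'I_m)
    (s : bool) (z n : 'rV[R]_m) : Prop :=
  let w := wedge (fun k => if k == i then n else partial psi z k) in
  [/\ dot n n = 1,
      forall k, k != i -> dot n (partial psi z k) = 0 &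
      if s then 0 <= w else w <= 0].

(* The normal is unique when the vectors partial psi z k, k != i, are linearly
   independent; otherwise area_element psi i z = 0 and the choice made by get
   is irrelevant. *)
Definition outward_normal m (psi : 'rV[R]_m -> 'rV[R]_m) (i : 'I_m) (s : bool)
    (z : 'rV[R]_m) : 'rV[R]_m :=
  get (is_outward_normal psi i s z).

Lemma dot_self_gt0 m (v : 'rV[R]_m) : v != 0 -> 0 < dot v v.
Proof.
move=> v0; rewrite lt_neqAle eq_sym sumr_ge0 ?andbT; last first.
  by move=> i _; rewrite -expr2 sqr_ge0.
apply: contra v0 => /eqP vv0; apply/eqP/rowP => i; rewrite mxE.
have sq_ge0 (j : 'I_m) : true -> 0 <= v 0 j * v 0 j.
  by move=> _; rewrite -expr2 sqr_ge0.
have /eqP := psumr_eq0P sq_ge0 vv0 (erefl : is_true (xpredT i)).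
by rewrite mulf_eq0 orbb => /eqP.
Qed.

Lemma outward_normalP m (psi : 'rV[R]_m -> 'rV[R]_m) (i : 'I_m) (s : bool)
  (z : 'rV[R]_m) : is_outward_normal psi i s z (outward_normal psi i s z).
Proof.
pose w n := wedge (fun k => if k == i then n else partial psi z k).
have [n [nn nO]] : exists n, dot n n = 1 /\
    forall k, k != i -> dot n (partial psi z k) = 0.
  pose M : 'M[R]_(m, m.-1) := \matrix_(a, j) partial psi z (lift i j) 0 a.
  have kM : kermx M != 0.
    rewrite -mxrank_eq0 mxrank_ker -lt0n subn_gt0.
    rewrite (leq_ltn_trans (rank_leq_col M))// prednK//.
    exact: leq_ltn_trans (leq0n i) (ltn_ord i).
  pose v := nz_row (kermx M).
  have v0 : v != 0 by rewrite nz_row_eq0.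
  have vM : v *m M = 0 by apply/sub_kermxP; exact: nz_row_sub.
  pose c := (Num.sqrt (dot v v))^-1.
  have vv := dot_self_gt0 v0.
  exists (c *: v); split.
    transitivity (c ^+ 2 * dot v v).
      by rewrite /dot mulr_sumr; apply: eq_bigr => k _; rewrite !mxE expr2 mulrACA.
    by rewrite /c exprVn sqr_sqrtr ?ltW// mulVf// gt_eqF.
  move=> k ki; have [j ->] : exists j, k = lift i j.
    by case: (unliftP i k) ki => [j -> _|->]; [exists j|rewrite eqxx].
  transitivity (c * (v *m M) 0 j); last by rewrite vM mxE mulr0.
  by rewrite /dot mxE mulr_sumr; apply: eq_bigr => a _; rewrite !mxE mulrA.
have wN : w (- n) = - w n.
  rewrite /w /wedge -[in LHS]det_tr -[in RHS]det_tr.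
  set B := (X in _ = - \det X).
  rewrite (@determinant_multilinear _ _ _ B B i (-1) 0).
  - by rewrite mul0r addr0 mulN1r.
  - by apply/rowP => a; rewrite !mxE eqxx !mxE mul0r addr0 mulN1r.
  - by apply/matrixP => a b; rewrite !mxE eq_sym (negbTE (neq_lift _ _)).
  - by apply/matrixP => a b; rewrite !mxE eq_sym (negbTE (neq_lift _ _)).
have dotN u v : dot (- u) v = - dot u v.
  by rewrite /dot -sumrN; apply: eq_bigr => k _; rewrite mxE mulNr.
have dotNN u : dot (- u) (- u) = dot u u.
  by apply: eq_bigr => k _; rewrite !mxE mulrNN.
have [sw|sw] := boolP (if s then 0 <= w n else w n <= 0).
  by apply: (@getI _ _ n); split.
apply: (@getI _ _ (- n)); split; rewrite ?dotNN//.
  by move=> k ki; rewrite dotN nO ?oppr0.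
rewrite -/(w _) wN; case: s sw; rewrite -ltNge => /ltW.
  by rewrite oppr_ge0.
by rewrite oppr_le0.
Qed.

(* Integral over the cycle psi(boundary of the cube) of h z n, where z is the
   parameter point and n the outward normal at z. *)
Definition oint m (psi : 'rV[R]_m -> 'rV[R]_m)
    (h : 'rV[R]_m -> 'rV[R]_m -> R) : R :=
  \sum_(i < m) \sum_(s : bool) int_cube (fun y : 'rV[R]_m.-1 =>
    let z := face_point i s y in
    h z (outward_normal psi i s z) * area_element psi i z).

(* 'J g x acts on row vectors on the right: it is the transpose of the matrix
   with columns partial g x k, with the same determinant. *)
Definition Jdet m (g : 'rV[R]_m -> 'rV[R]_m) (x : 'rV[R]_m) : R := \det ('J g x).

End defs.

(* Main.v *)
(* The pull-back of the m-form f dp_1 /\ ... /\ dp_m by the map (t, x) |-> phi(x, t)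
   lives on an (m+1)-dimensional box with time as first coordinate.  Stokes'
   formula on [t, s] x cube gives
     F(s) - F(t) = (bulk integral of d_t f J) + (integrals over the lateral faces),
   where F is the integral to be differentiated; dividing by s - t and letting s
   tend to t, by dominated convergence, yields the theorem.

   As phi is only C^1, Stokes' formula cannot be obtained by differentiating
   minors of its Jacobian.  It is multilinear in n+1 scalar C^1 functions:
     (boundary integral of u_0 du_1 /\ ... /\ du_n)
       = (integral over the cube of du_0 /\ du_1 /\ ... /\ du_n),
   so it suffices to prove it on a dense class.  Tensor-product Bernstein
   polynomials, with their partial derivatives, converge boundedly and pointwise
   to u and its partial derivatives, and for products of one-variable polynomials
   the formula reduces to the product rule and the cancellation of second
   derivatives in an alternating sum over permutations. *)

Require Import Defs.
From mathcomp Require Import all_boot all_order all_algebra fingroup perm.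
From mathcomp Require Import all_classical all_reals all_analysis.
From mathcomp Require Import measurable_realfun ring lra.
Import Order.TTheory GRing.Theory Num.Theory.
Import numFieldNormedType.Exports.
Local Open Scope classical_set_scope.
Local Open Scope ring_scope.

Set Implicit Arguments.
Unset Strict Implicit.
Unset Printing Implicit Defensive.

(** * Integration over the open cube *)

(** The Jacobian determinant is merely continuous in time, so the integrand cannot be differentiated
    under the integral sign; only a finite increment has a formula. Time is rescaled to [0, 1]: all
    increments then live on one fixed unit cube, [s < t] is allowed, and the factor [s - t] coming
    out of the time column cancels against the difference quotient. The normal may be discontinuous,
    and is arbitrary at singular points, so no limit is taken with it: the lateral terms are
    determinants ([flux]), continuous up to the boundary, which are identified with normal times
    area at the fixed time [t] only. Bernstein convergence is Chebyshev's inequality: the weights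
    are products of binomial laws, with variance of order 1/N. A partial derivative of the
    approximation is again an average of this kind, of values of the partial derivative at mean
    value points. Convergence has to hold on the closed cube, since the faces are integrated over as
    well. *)

Section cube_integral.
Context {R : realType}.
Local Notation T := (measurableTypeR R).

Definition tuple_cube n : set (n.-tuple T) :=
  @tuple_row R n @^-1` @open_cube R n.

Lemma tuple_cubeE n :
  @tuple_cube n = [set y | forall i, tnth y i \in `]0, 1[].
Proof.
apply/seteqP; split=> y /= h i; have := h i; rewrite !mxE ?in_itv //=.
Qed.

Lemma measurable_tuple_cube n : measurable (@tuple_cube n).
Proof.
have -> : @tuple_cube n =
    \bigcap_(i in [set: 'I_n]) (setT `&` (@tnth n T)^~ i @^-1` `]0, 1[%classic).
  rewrite tuple_cubeE; apply/seteqP; split=> [y yc i _|y yc i].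
    by split=> //=; exact: yc.
  by have [] := yc i I.
apply: fin_bigcap_measurable => // i _.
by apply: measurable_tnth => //; exact: measurable_itv.
Qed.

Lemma cons_pair_cube n : @cons_pair R n @^-1` @tuple_cube n.+1 =
  `]0, 1[%classic `*` @tuple_cube n.
Proof.
rewrite !tuple_cubeE; apply/seteqP; split=> [[a y] /= h|[a y] /= [ha h] i].
- split; first by have := h ord0; rewrite tnth0.
  by move=> i; have := h (lift ord0 i); rewrite tnthS.
- by case: (unliftP ord0 i) => [j ->|->]; rewrite ?tnthS ?tnth0.
Qed.

Lemma lebesgue_tuple_cube n : lebesgue_tuple n (@tuple_cube n) = 1%E.
Proof.
elim: n => [|n IHn]; rewrite /=.
  rewrite /dirac indicE mem_set //.
  by rewrite tuple_cubeE => -[].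
rewrite /lebesgue_cons /pushforward cons_pair_cube product_measure1E //=.
  rewrite IHn mule1 lebesgue_measure_itv/= lte_fin ltr01 oppr0 adde0 //.
exact: measurable_tuple_cube.
Qed.

Definition cube_measurable n (g : 'rV[R]_n -> R) :=
  measurable_fun (@tuple_cube n) (fun y => g (@tuple_row R n y)).

Definition cube_bounded n (g : 'rV[R]_n -> R) :=
  exists M : R, forall x, open_cube x -> `|g x| <= M.

Lemma bounded_cube_integrable n (g : 'rV[R]_n -> R) :
  cube_measurable g -> cube_bounded g ->
  (lebesgue_tuple n).-integrable (@tuple_cube n)
     (EFin \o (fun y => g (@tuple_row R n y))).
Proof.
move=> mg [M gM]; apply: measurable_bounded_integrable => //.
- exact: measurable_tuple_cube.
- by rewrite [X in (X < _)%E](lebesgue_tuple_cube n) ltry.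
- exists M; split; first exact: num_real.
  by move=> e Me y yc /=; rewrite (le_trans (gM _ _)) // ltW.
Qed.

Lemma eq_int_cube n (g h : 'rV[R]_n -> R) :
  (forall x, open_cube x -> g x = h x) -> int_cube g = int_cube h.
Proof.
move=> gh; rewrite /int_cube; apply: eq_Rintegral => y; rewrite inE => yc.
exact: gh.
Qed.

Lemma int_cubeZ n c (g : 'rV[R]_n -> R) : cube_measurable g -> cube_bounded g ->
  int_cube (fun x => c * g x) = c * int_cube g.
Proof.
move=> mg bg; rewrite /int_cube RintegralZl //; first exact:
    measurable_tuple_cube.
exact: bounded_cube_integrable.
Qed.

Lemma cube_boundedD n (g h : 'rV[R]_n -> R) :
  cube_bounded g -> cube_bounded h -> cube_bounded (fun x => g x + h x).
Proof.
move=> [M gM] [N hN]; exists (M + N) => x xc.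
by rewrite (le_trans (ler_normD _ _)) // lerD ?gM ?hN.
Qed.

Lemma cube_boundedM n (g h : 'rV[R]_n -> R) :
  cube_bounded g -> cube_bounded h -> cube_bounded (fun x => g x * h x).
Proof.
move=> [M gM] [N hN]; exists (M * N) => x xc.
by rewrite normrM ler_pM ?gM ?hN.
Qed.

Lemma cube_measurable_sum n (I : Type) (r : seq I) (P : pred I)
    (g : I -> 'rV[R]_n -> R) :
  (forall i, P i -> cube_measurable (g i)) ->
  cube_measurable (fun x => \sum_(i <- r | P i) g i x).
Proof.
move=> mg; elim: r => [|i r IH]; rewrite /cube_measurable.
  by under eq_fun do rewrite big_nil; exact: measurable_cst.
under eq_fun do rewrite big_cons.
case Pi : (P i) => //; exact: measurable_funD (mg i Pi) IH.
Qed.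

Lemma cube_measurable_prod n (I : Type) (r : seq I) (P : pred I)
    (g : I -> 'rV[R]_n -> R) :
  (forall i, P i -> cube_measurable (g i)) ->
  cube_measurable (fun x => \prod_(i <- r | P i) g i x).
Proof.
move=> mg; elim: r => [|i r IH]; rewrite /cube_measurable.
  by under eq_fun do rewrite big_nil; exact: measurable_cst.
under eq_fun do rewrite big_cons.
case Pi : (P i) => //; exact: measurable_funM (mg i Pi) IH.
Qed.

Lemma cube_bounded_cst n (c : R) : cube_bounded (fun _ : 'rV[R]_n => c).
Proof. by exists `|c|. Qed.

Lemma cube_bounded_sum n (I : Type) (r : seq I) (P : pred I)
    (g : I -> 'rV[R]_n -> R) :
  (forall i, P i -> cube_bounded (g i)) ->
  cube_bounded (fun x => \sum_(i <- r | P i) g i x).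
Proof.
move=> bg; elim: r => [|i r IH].
  by under eq_fun do rewrite big_nil; exact: cube_bounded_cst.
under eq_fun do rewrite big_cons.
case Pi : (P i) => //; exact: cube_boundedD (bg i Pi) IH.
Qed.

Lemma int_cubeD n (g h : 'rV[R]_n -> R) : cube_measurable g -> cube_bounded g ->
  cube_measurable h -> cube_bounded h ->
  int_cube (fun x => g x + h x) = int_cube g + int_cube h.
Proof.
move=> mg bg mh bh; rewrite /int_cube RintegralD //; first exact:
    measurable_tuple_cube.
all: exact: bounded_cube_integrable.
Qed.

Lemma int_cube0 n : int_cube (fun _ : 'rV[R]_n => 0) = 0.
Proof.
rewrite /int_cube Rintegral_cst ?mul0r //; exact: measurable_tuple_cube.
Qed.

Lemma int_cube_sum n (I : Type) (r : seq I) (P : pred I)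
    (g : I -> 'rV[R]_n -> R) :
  (forall i, P i -> cube_measurable (g i)) ->
  (forall i, P i -> cube_bounded (g i)) ->
  int_cube (fun x => \sum_(i <- r | P i) g i x) =
  \sum_(i <- r | P i) int_cube (g i).
Proof.
move=> mg bg; elim: r => [|i r IH].
  by under eq_int_cube do rewrite big_nil; rewrite int_cube0 big_nil.
rewrite big_cons -IH; under eq_int_cube do rewrite big_cons.
case Pi : (P i) => //; rewrite int_cubeD //.
- exact: mg.
- exact: bg.
- exact: cube_measurable_sum.
- exact: cube_bounded_sum.
Qed.

(** The hypotheses of dominated convergence by a constant, the cube having measure 1. The set is a
    parameter: integrals only see the open cube, but restriction to a face needs the closed one. *)
Definition bounded_cvg n (D : set 'rV[R]_n) (g_ : nat -> 'rV[R]_n -> R)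
    (g : 'rV[R]_n -> R) :=
  (exists M : R, forall N x, D x -> `|g_ N x| <= M) /\
  (forall x, D x -> g_ N x @[N --> \oo] --> g x).

Lemma int_cube_cvg n (g_ : nat -> 'rV[R]_n -> R) (g : 'rV[R]_n -> R) :
  (forall N, cube_measurable (g_ N)) ->
  bounded_cvg (@open_cube R n) g_ g ->
  int_cube (g_ N) @[N --> \oo] --> int_cube g.
Proof.
move=> mg [[M gM] gg].
have mcg : cube_measurable g.
  apply: (@measurable_fun_cvg _ _ _ _ (fun N y => g_ N (@tuple_row R n y))) => //.
  by move=> y yc; exact: gg.
have bg : cube_bounded g.
  exists M => x xc; have := gg x xc => /cvg_norm h.
  apply: (cvgr_to_le h); apply: nearW => N; exact: gM.
have := @dominated_cvg _ _ R (lebesgue_tuple n) _ (@measurable_tuple_cube n)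
  (fun N y => (g_ N (@tuple_row R n y))%:E) (fun y => (g (@tuple_row R n y))%:E)
  (fun=> M%:E).
have ifin := bounded_cube_integrable mcg bg.
move=> H; apply: fine_cvg; rewrite fineK; last first.
  apply: integrable_fin_num => //; exact: measurable_tuple_cube.
apply: H.
- by move=> N; apply/measurable_EFinP; exact: mg.
- by move=> y yc; apply/fine_cvgP; split; [exact: nearW|exact: gg].
- by [].
- have mM : cube_measurable (fun _ : 'rV[R]_n => M) by exact: measurable_cst.
  exact (bounded_cube_integrable mM (cube_bounded_cst n M)).
- by move=> N y yc; rewrite /= lee_fin gM.
Qed.

End cube_integral.

Section cube_fubini.
Context {R : realType}.
Local Notation T := (measurableTypeR R).
Local Notation I01 := (`]0, 1[%classic : set T).
Local Notation lambda := (@lebesgue_measure R).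

(** [lebesgue_tuple n.+1] is the image of a product measure under [cons_pair], so a change of
    variables leads to an integral over the product, where Fubini separates the factors. *)
Lemma int_cube_cons n (p : T -> R) (h : 'rV[R]_n -> R) :
  measurable_fun I01 p -> (exists M, forall a, I01 a -> `|p a| <= M) ->
  cube_measurable h -> cube_bounded h ->
  int_cube (fun x : 'rV[R]_n.+1 => p (x 0 0) * h (\row_j x 0 (lift ord0 j))) =
  (\int[lambda]_(a in I01) p a) * int_cube h.
Proof.
move=> mp [M pM] mh bh.
have mI : measurable I01 by exact: measurable_itv.
have mC := @measurable_tuple_cube R n.
have mC1 := @measurable_tuple_cube R n.+1.
set G := fun x : 'rV[R]_n.+1 => _.
pose g (y : n.+1.-tuple T) := (G (tuple_row y))%:E.
pose D : set (T * n.-tuple T) := I01 `*` @tuple_cube R n.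
pose f (z : T * n.-tuple T) := (p z.1 * h (tuple_row z.2))%:E.
have gf z : g (cons_pair z) = f z.
  rewrite /g /G /f !mxE tnth0; congr ((_ * h _)%:E).
  by apply/rowP => j; rewrite !mxE tnthS.
have mD : measurable D by exact: measurableX.
have mf : measurable_fun D f.
  have m1 : measurable_fun D (p \o fst).
    apply: (measurable_comp mI _ mp); last exact: measurable_funTS.
    by move=> _ [[a y] [? ?] <-].
  have m2 : measurable_fun D ((fun y => h (tuple_row y)) \o snd).
    apply: (measurable_comp mC _ mh); last exact: measurable_funTS.
    by move=> _ [[a y] [? ?] <-].
  by apply/measurable_EFinP; exact: measurable_funM m1 m2.
have lD : (lambda \x lebesgue_tuple n)%E D = 1%E.
  rewrite product_measure1E //= lebesgue_measure_itv /= lte_fin ltr01.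
  by rewrite (lebesgue_tuple_cube n) oppr0 adde0 mule1.
have intf : (lambda \x lebesgue_tuple n)%E.-integrable D f.
  apply: (@measurable_bounded_integrable _ _ _ _ _ _ mD).
  - by rewrite [X in (X < _)%E]lD ltry.
  - by apply/measurable_EFinP.
  - case: bh => N hN; exists (M * N); split; first exact: num_real.
    move=> e Me [a y] [/= Da Dy]; rewrite (le_trans _ (ltW Me)) //.
    by rewrite normrM ler_pM ?pM // hN.
(* Head and tail invert [cons_pair], so [g] is [f] after a measurable map. *)
have mg : measurable_fun (@tuple_cube R n.+1) g.
  pose u (x : n.+1.-tuple T) : T * n.-tuple T := (thead x, [tuple of behead x]).
  have uK x : cons_pair (u x) = x by rewrite [RHS]tuple_eta; apply/val_inj.
  have mu : measurable_fun setT u.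
    by apply/measurable_fun_pair; [exact: measurable_tnth|exact:
        measurable_behead].
  have -> : g = f \o u by apply/funext => x; rewrite /= -gf uK.
  apply: (@measurable_comp _ _ _ _ _ _ D) => //.
  - move=> _ [x xc <-].
    have : (@cons_pair R n @^-1` @tuple_cube R n.+1) (u x) by rewrite /= uK.
    by rewrite cons_pair_cube.
  - exact: measurable_funTS.
have D'E : @cons_pair R n @^-1` @tuple_cube R n.+1 = D := cons_pair_cube n.
rewrite [LHS]/int_cube /Rintegral -/(tuple_cube _).
transitivity (fine (\int[(lambda \x lebesgue_tuple n)%E]_z (f \_ D) z)).
  congr fine.
  transitivity (\int[pushforward (lambda \x lebesgue_tuple n)%E (@cons_pair R
      n)]_(y in @tuple_cube R n.+1) g y)%E; first by [].
  rewrite integral_mkcond; [exact: measurable_cons_pair|move=> mcons].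
  have gfD : (g \_ (@tuple_cube R n.+1)) \o @cons_pair R n = f \_ D.
    rewrite -D'E; apply/funext => z /=; rewrite /patch /= gf.
    by have -> : (cons_pair z \in @tuple_cube R n.+1) =
      (z \in @cons_pair R n @^-1` @tuple_cube R n.+1)
      by apply/idP/idP; rewrite !inE.
  refine (etrans (@integral_pushforward _ _ _ _ R (@cons_pair R n) _ (lambda \x
      lebesgue_tuple n)%E setT (g \_ (@tuple_cube R n.+1)) _ _ _) _) => //.
  - by apply/(measurable_restrictT _ mC1).
  - by rewrite preimage_setT gfD; apply/(integrable_mkcond _ mD).
  - by rewrite preimage_setT gfD.
rewrite -integral12_prod_meas1; last exact/(integrable_mkcond _ mD).
have iE a : fubini_F (lebesgue_tuple n) (f \_ D) a =
   ((fun a => (p a * int_cube h)%:E) \_ I01) a.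
  rewrite /fubini_F /patch; case: ifPn => aI.
    transitivity (\int[lebesgue_tuple n]_(y in @tuple_cube R n) (p a * h
        (tuple_row y))%:E)%E.
      rewrite [RHS]integral_mkcond; apply: eq_integral => y _; rewrite /patch.
      have -> // : ((a, y) \in D) = (y \in @tuple_cube R n).
      move: aI; rewrite inE => aI.
      by apply/idP/idP; rewrite !inE /D; [case|move=> yc; split].
    have := @int_cubeZ R n (p a) h mh bh; rewrite {1}/int_cube => <-.
    rewrite /Rintegral fineK //; apply: integrable_fin_num => //.
    apply: (@bounded_cube_integrable _ _ (fun x => p a * h x)).
      by apply: measurable_funM => //; exact: measurable_cst.
    by apply: cube_boundedM => //; exact: cube_bounded_cst.
  rewrite (eq_integral (cst 0%E)) ?integral0 // => y _.
  rewrite ifF //; apply/negP; rewrite inE => -[/= aI' _].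
  by case/negP: aI; rewrite inE.
rewrite (eq_integral _ _ (fun a _ => iE a)) -integral_mkcond -/(Rintegral _ _ _).
rewrite [LHS]RintegralZr //; apply: measurable_bounded_integrable => //.
  by rewrite /= lebesgue_measure_itv /= lte_fin ltr01 oppr0 adde0 ltry.
exists M; split; first exact: num_real.
by move=> e Me y yc /=; rewrite (le_trans (pM _ yc)) // ltW.
Qed.

End cube_fubini.

(** * Integrals of products of one-variable polynomials *)

Section product_polynomials.
Context {R : realType}.
Local Notation T := (measurableTypeR R).
Local Notation I01 := (`]0, 1[%classic : set T).
Local Notation lambda := (@lebesgue_measure R).

Lemma open_closed_cube n (x : 'rV[R]_n) : open_cube x -> closed_cube x.
Proof. by move=> xc i; have /andP[? ?] := xc i; rewrite !ltW. Qed.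

Definition poly_int01 (p : {poly R}) : R := \int[lambda]_(a in I01) p.[a].

Lemma horner_bounded01 (p : {poly R}) :
  exists M : R, forall a, 0 <= a <= 1 -> `|p.[a]| <= M.
Proof.
exists (\sum_(i < size p) `|p`_i|) => a /andP[a0 a1].
rewrite horner_coef (le_trans (ler_norm_sum _ _ _)) // ler_sum // => i _.
by rewrite normrM [`|a ^+ i|]ger0_norm ?exprn_ge0// ler_piMr// exprn_ile1.
Qed.

Lemma horner_integrable (D : set T) (p : {poly R}) : measurable D ->
  D `<=` `[0, 1]%classic -> lambda.-integrable D (EFin \o (fun a => p.[a])).
Proof.
move=> mD D01.
have mI : measurable (`[0, 1]%classic : set T) by exact: measurable_itv.
apply: (integrableS mI mD D01).
apply: measurable_bounded_integrable.
- exact: measurable_itv.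
- by rewrite /= lebesgue_measure_itv /= lte_fin ltr01 oppr0 adde0 ltry.
- exact: measurable_poly.
- have [M pM] := horner_bounded01 p; exists M; split; first exact: num_real.
  by move=> e Me y /=; rewrite in_itv /= => y01; rewrite (le_trans (pM _ y01))
      ?ltW.
Qed.

Lemma horner_integrable01 (p : {poly R}) :
  lambda.-integrable I01 (EFin \o (fun a => p.[a])).
Proof.
by apply: horner_integrable; [exact: measurable_itv|exact: subset_itv_oo_cc].
Qed.

Lemma poly_int01D p q : poly_int01 (p + q) = poly_int01 p + poly_int01 q.
Proof.
rewrite /poly_int01 -RintegralD //; [|exact: horner_integrable01..].
by apply: eq_Rintegral => a _; rewrite hornerD.
Qed.

Lemma poly_int010 : poly_int01 0 = 0.
Proof.
rewrite /poly_int01 (@eq_Rintegral _ _ _ _ _ (cst 0)).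
  by rewrite Rintegral_cst ?mul0r //; exact: measurable_itv.
by move=> a _; rewrite horner0.
Qed.

Lemma poly_int01_sum (I : Type) (r : seq I) (P : pred I) (F : I -> {poly R}) :
  poly_int01 (\sum_(i <- r | P i) F i) = \sum_(i <- r | P i) poly_int01 (F i).
Proof. exact: (big_morph _ poly_int01D poly_int010). Qed.

Lemma poly_int01_deriv (p : {poly R}) : poly_int01 p^`() = p.[1] - p.[0].
Proof.
rewrite /poly_int01 Rintegral_itv_bndo_bndc; last exact: horner_integrable01.
rewrite Rintegral_itv_obnd_cbnd; last first.
  by apply: horner_integrable; [exact: measurable_itv|exact: subset_itv_oc_cc].
rewrite /Rintegral (@continuous_FTC2 _ _ (fun a => p.[a])) //=.
- apply: continuous_subspaceT; exact: continuous_horner.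
- split; first by move=> x _; exact: derivable_horner.
  + by apply: cvg_at_right_filter; exact: continuous_horner.
  + by apply: cvg_at_left_filter; exact: continuous_horner.
- by move=> x _; rewrite -derivE.
Qed.

Definition tensor_poly n (q : 'I_n -> {poly R}) : 'rV[R]_n -> R :=
  fun x => \prod_i (q i).[x 0 i].

Lemma tensor_poly_measurable n (q : 'I_n -> {poly R}) : cube_measurable
    (tensor_poly q).
Proof.
apply: cube_measurable_prod => i _; rewrite /cube_measurable.
have -> : (fun y : n.-tuple T => (q i).[tuple_row y 0 i]) =
   (fun a => (q i).[a]) \o (@tnth n T ^~ i).
  by apply/funext => y; rewrite /= !mxE.
apply: (measurable_comp measurableT) => //; first exact: measurable_poly.
by apply: measurable_funTS; exact: measurable_tnth.
Qed.

Lemma tensor_poly_bounded n (q : 'I_n -> {poly R}) :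
  exists M : R, forall x, closed_cube x -> `|tensor_poly q x| <= M.
Proof.
have /choice[M hM] i := horner_bounded01 (q i).
exists (\prod_i M i) => x xc; rewrite /tensor_poly normr_prod.
by apply: ler_prod => i _; rewrite normr_ge0 hM.
Qed.

Lemma tensor_poly_cube_bounded n (q : 'I_n -> {poly R}) : cube_bounded
    (tensor_poly q).
Proof.
by have [M qM] := tensor_poly_bounded q; exists M => x /open_closed_cube;
    exact: qM.
Qed.

Lemma int_cube_tensor_poly n (q : 'I_n -> {poly R}) :
  int_cube (tensor_poly q) = \prod_i poly_int01 (q i).
Proof.
elim: n q => [|n IHn] q.
  rewrite big_ord0 (@eq_int_cube _ _ _ (fun=> 1)); last by move=> x _; rewrite
      /tensor_poly big_ord0.
  rewrite /int_cube Rintegral_cst; last exact: measurable_tuple_cube.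
  by rewrite mul1r [X in fine X](lebesgue_tuple_cube 0).
rewrite big_ord_recl -IHn.
have -> : int_cube (tensor_poly q) = int_cube (fun x : 'rV_n.+1 => (q ord0).[x
    0 0] *
    tensor_poly (fun i => q (lift ord0 i)) (\row_j x 0 (lift ord0 j))).
  apply: eq_int_cube => x _; rewrite /tensor_poly big_ord_recl; congr (_ * _).
  by apply: eq_bigr => i _; rewrite mxE.
rewrite (@int_cube_cons _ _ (fun a => (q ord0).[a])) //.
- exact: measurable_poly.
- have [M qM] := horner_bounded01 (q ord0); exists M => a /=.
  by rewrite in_itv /= => /andP[? ?]; rewrite qM // !ltW.
- exact: tensor_poly_measurable.
- exact: tensor_poly_cube_bounded.
Qed.

Lemma tensor_poly_face n (q : 'I_n.+1 -> {poly R}) i (s : bool) y :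
  tensor_poly q (face_point i s y) = (q i).[s%:R] * tensor_poly (fun j => q
      (lift i j)) y.
Proof.
rewrite /tensor_poly (bigD1_ord i) //= mxE unlift_none; congr (_ * _).
by apply: eq_bigr => j _; rewrite mxE liftK.
Qed.

Lemma tensor_poly_prod n (I : finType) (P : pred I) (q : I -> 'I_n -> {poly R})
    x :
  \prod_(j | P j) tensor_poly (q j) x = tensor_poly (fun i => \prod_(j | P j) q
      j i) x.
Proof.
rewrite /tensor_poly exchange_big /=; apply: eq_bigr => i _.
by rewrite horner_prod.
Qed.

End product_polynomials.

(** * Stokes' formula for products of one-variable polynomials *)

Section product_stokes.
Context {R : realType}.

Lemma deriv_prod_ord n (p : 'I_n -> {poly R}) :
  (\prod_j p j)^`() = \sum_k \prod_j (if j == k then (p j)^`() else p j).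
Proof.
elim: n p => [|n IHn] p; first by rewrite !big_ord0 derivC.
rewrite big_ord_recl derivM IHn big_ord_recl; congr (_ + _).
  by rewrite big_ord_recl eqxx; congr (_ * _).
rewrite mulr_sumr; apply: eq_bigr => k _; rewrite big_ord_recl /=; congr (_ * _).
Qed.

(** Reindexing by the transposition flips every sign and fixes every [F s], so the sum is its own
    opposite. *)
Lemma sum_perm_sign0 n (k : 'I_n.+1) (F : 'S_n.+1 -> R) : k != ord0 ->
  (forall s, F (tperm ord0 k * s)%g = F s) ->
  \sum_s (-1) ^+ odd_perm s * F s = 0.
Proof.
move=> k0 Ft; set S := LHS; suff : S = - S by lra.
rewrite {1}/S (reindex_inj (mulgI (tperm ord0 k))) /= -sumrN.
apply: eq_bigr => s _; rewrite Ft odd_permM odd_tperm eq_sym k0.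
by rewrite signr_addb mulN1r mulNr.
Qed.

Variables (n : nat) (P : 'I_n.+1 -> 'I_n.+1 -> {poly R}).

Definition deriv_if (b : bool) (p : {poly R}) := if b then p^`() else p.

(* The product rule turns the boundary term of s into a sum over the row k that
   gets differentiated in direction s 0.  The row k = 0 gives the right-hand side;
   the term of a row k != 0 is invariant under s |-> tperm 0 k * s, so these terms
   cancel in pairs. *)
Lemma stokes_poly :
  \sum_(s : 'S_n.+1) (-1) ^+ odd_perm s *
    (((\prod_j deriv_if ((j != ord0) && (s j == s ord0)) (P j (s ord0))).[1]
     - (\prod_j deriv_if ((j != ord0) && (s j == s ord0)) (P j (s ord0))).[0]) *
     \prod_l poly_int01 (\prod_j deriv_if ((j != ord0) && (s j == lift (s ord0)
         l))
        (P j (lift (s ord0) l))))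
  = \sum_(s : 'S_n.+1) (-1) ^+ odd_perm s *
      \prod_i poly_int01 (\prod_j deriv_if (s j == i) (P j i)).
Proof.
pose F k (s : 'S_n.+1) := \prod_i poly_int01 (\prod_j
  deriv_if ((j != ord0) && (s j == i) || (j == k) && (s ord0 == i)) (P j i)).
transitivity (\sum_(s : 'S_n.+1) (-1) ^+ odd_perm s * \sum_k F k s).
  apply: eq_bigr => s _; congr (_ * _); rewrite -poly_int01_deriv.
  rewrite deriv_prod_ord poly_int01_sum mulr_suml; apply: eq_bigr => k _.
  rewrite /F [RHS](bigD1_ord (s ord0)) //=; congr (_ * _).
    (* As [s] is injective, only row [0] has direction [s ord0], so nothing was differentiated in
       that variable before the product rule. *)
    congr poly_int01; apply: eq_bigr => j _; rewrite eqxx andbT (inj_eq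
        perm_inj) andNb /=.
    by case: eqP.
  apply: eq_bigr => l _; congr poly_int01; apply: eq_bigr => j _.
  by rewrite (negbTE (neq_lift _ _)) andbF orbF.
under eq_bigr do rewrite mulr_sumr.
rewrite exchange_big /= big_ord_recl [X in _ + X]big1 ?addr0 => [|k _].
  apply: eq_bigr => s _; congr (_ * _); apply: eq_bigr => i _; congr poly_int01.
  apply: eq_bigr => j _; congr deriv_if.
  by case: (eqVneq j ord0) => [->|_] //=; rewrite orbF.
apply: (@sum_perm_sign0 _ (lift ord0 k)) => // s.
rewrite /F; apply: eq_bigr => i _; congr poly_int01; apply: eq_bigr => j _.
(* Row [lift ord0 k] is differentiated in the two directions [s ord0] and [s (lift ord0 k)], which
   the transposition merely exchanges. *)
congr deriv_if; rewrite !permM tpermL.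
case: (eqVneq j ord0) => [->|j0] //=.
case: (eqVneq j (lift ord0 k)) => [->|jk] /=; first by rewrite tpermR orbC.
by rewrite tpermD // eq_sym.
Qed.

End product_stokes.

(** * Bernstein approximation in C^1 *)

Section bernstein.
Context {R : realType}.

(* 'C(N, k) 'X^k (1 - 'X)^(N - k), presented by Pascal's rule: this gives positivity,
   moments and derivatives by induction, without binomial coefficients. *)
Fixpoint bernstein (N k : nat) : {poly R} :=
  if N is N'.+1 then
    (1 - 'X) * bernstein N' k + 'X * (if k is k'.+1 then bernstein N' k' else 0)
  else (k == 0)%:R%:P.

Definition bernstein_pred N k := if k is k'.+1 then bernstein N k' else 0.

#[global] Arguments bernstein : simpl never.

Lemma bernstein0 k : bernstein 0 k = (k == 0)%:R%:P.
Proof. by []. Qed.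

Lemma bernsteinS N k : bernstein N.+1 k = (1 - 'X) * bernstein N k + 'X *
    bernstein_pred N k.
Proof. by []. Qed.

Lemma horner_bernsteinS N k x : (bernstein N.+1 k).[x] =
  (1 - x) * (bernstein N k).[x] + x * (bernstein_pred N k).[x].
Proof. by rewrite bernsteinS hornerD !hornerM hornerX hornerD hornerN hornerX
    hornerC. Qed.

Lemma bernstein_eq0 N k : (N < k)%N -> bernstein N k = 0.
Proof.
elim: N k => [|N IH] [|k] //= Nk.
by rewrite bernsteinS /= !IH ?mulr0 ?addr0 // ltnW.
Qed.

Lemma bernstein_ge0 N k x : 0 <= x <= 1 -> 0 <= (bernstein N k).[x].
Proof.
move=> /andP[x0 x1]; elim: N k => [|N IH] k.
  by rewrite bernstein0 hornerC.
rewrite horner_bernsteinS addr_ge0 ?mulr_ge0 ?subr_ge0 //.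
by case: k => [|k] /=; rewrite ?horner0.
Qed.

Lemma deriv_bernstein N k :
  (bernstein N.+1 k)^`() = N.+1%:R *: (bernstein_pred N k - bernstein N k).
Proof.
rewrite scaler_nat -mulr_natr.
elim: N k => [|N IH] k; rewrite bernsteinS derivD !derivM derivB derivX derivC.
  case: k => [|[|k]]; rewrite /= ?bernstein0 ?poly.derivE /=; ring.
case: k => [|k] /=; rewrite ?deriv0 !IH !bernsteinS /=; ring.
Qed.

(** Moments of the binomial law. Pascal's rule shifts the index by one, which turns one quadratic
    weight into another: [a], [b], [c] have to vary in the induction, and so does the range [M]. *)
Lemma bernstein_moment N M a b c x : (N < M)%N ->
  \sum_(k < M) (a + b * k%:R + c * k%:R ^+ 2) * (bernstein N k).[x] =
  a + b * (N%:R * x) + c * (N%:R * x * (1 - x) + (N%:R * x) ^+ 2).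
Proof.
elim: N M a b c => [|N IH] [//|M] a b c NM.
  rewrite big_ord_recl big1 => [|i _]; rewrite ?bernstein0 ?hornerE ?mulr0 //=.
  by ring.
have E : \sum_(k < M.+1) (a + b * k%:R + c * k%:R ^+ 2) * (bernstein N.+1 k).[x] =
   (1 - x) * (\sum_(k < M.+1) (a + b * k%:R + c * k%:R ^+ 2) * (bernstein N
       k).[x])
   + x * (\sum_(k < M) ((a + b + c) + (b + 2 * c) * k%:R + c * k%:R ^+ 2)
            * (bernstein N k).[x]).
  transitivity (\sum_(k < M.+1) ((1 - x) * ((a + b * k%:R + c * k%:R ^+ 2) *
      (bernstein N k).[x])
    + x * ((a + b * k%:R + c * k%:R ^+ 2) * (bernstein_pred N k).[x]))).
    apply: eq_bigr => k _; rewrite horner_bernsteinS; ring.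
  rewrite big_split -!mulr_sumr; congr (_ + x * _).
  rewrite big_ord_recl /= horner0 mulr0 add0r; apply: eq_bigr => k _.
  rewrite /bump /= add1n -natr1; ring.
rewrite E !IH ?(ltnW NM) // -[N.+1%:R]natr1; ring.
Qed.

End bernstein.

Section bernstein_average.
Context {R : realType}.

Lemma sum_bernstein N M (x : R) : (N < M)%N -> \sum_(k < M) (bernstein N k).[x]
    = 1.
Proof.
move=> NM; have := bernstein_moment 1 0 0 x NM; rewrite !mul0r !addr0 => <-.
by apply: eq_bigr => k _; rewrite !mul0r !addr0 mul1r.
Qed.

Section product_weight.
Variables (n M : nat) (b : 'I_n -> 'I_M -> R).
Hypothesis b1 : forall i, \sum_a b i a = 1.

Lemma sum_product_weight : \sum_(k : {ffun 'I_n -> 'I_M}) \prod_i b i (k i) = 1.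
Proof. by rewrite -(bigA_distr_bigA b) big1. Qed.

(** Marginal of a product weight: every coordinate other than [j] sums to 1. *)
Lemma sum_product_weight1 j (g : 'I_M -> R) :
  \sum_(k : {ffun 'I_n -> 'I_M}) g (k j) * \prod_i b i (k i) =
  \sum_a g a * b j a.
Proof.
pose b' i a := if i == j then g a * b j a else b i a.
transitivity (\sum_(k : {ffun 'I_n -> 'I_M}) \prod_i b' i (k i)).
  apply: eq_bigr => k _; rewrite (bigD1 j) //= [RHS](bigD1 j) //= {1}/b' eqxx.
  rewrite mulrA; congr (_ * _); apply: eq_bigr => i /negbTE ij.
  by rewrite /b' ij.
rewrite -(bigA_distr_bigA b') (bigD1 j) //= [X in _ * X]big1 => [|i /negbTE ij].
  by rewrite mulr1; apply: eq_bigr => a _; rewrite /b' eqxx.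
by rewrite -[RHS](b1 i); apply: eq_bigr => a _; rewrite /b' ij.
Qed.

End product_weight.

(** Chebyshev's argument, pointwise: where all coordinates are within [d] of [x], continuity gives
    [e]; elsewhere the squared distance is at least [d ^+ 2] and the left-hand side at most [2 * M],
    whence [C = 2 * M / d ^+ 2]. A quadratic bound can be averaged using second moments. *)
Lemma continuous_within_quadratic n (D : set 'rV[R]_n) (h : 'rV[R]_n -> R) M x e :
  h y @[y --> within D (nbhs x)] --> h x ->
  (forall y, D y -> `|h y| <= M) -> D x -> 0 < e ->
  exists2 C, 0 <= C & forall y, D y ->
    `|h y - h x| <= e + C * \sum_j (y 0 j - x 0 j) ^+ 2.
Proof.
move=> hx hM Dx e0.
have [d /= d0 dh] : exists2 d, 0 < d & forall y, D y ->
    (forall j, `|y 0 j - x 0 j| < d) -> `|h y - h x| <= e.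
  move/cvgrPdist_le : hx => /(_ _ e0).
  rewrite near_withinE => /nbhs_ballP[d /= d0 dP]; exists d => // y Dy yx.
  rewrite distrC; apply: dP => //; split=> [//|i j]; rewrite ord1.
  by rewrite -ball_normE /= distrC.
have M0 : 0 <= M by apply: le_trans (hM _ Dx).
have d0' : 0 <= d by exact: ltW.
exists (2 * M / d ^+ 2) => [|y Dy]; first by rewrite divr_ge0 ?mulr_ge0
    ?exprn_ge0.
have sge j : (y 0 j - x 0 j) ^+ 2 <= \sum_j (y 0 j - x 0 j) ^+ 2.
  by rewrite (bigD1 j) //= lerDl sumr_ge0 // => i _; rewrite sqr_ge0.
have S0 : 0 <= \sum_j (y 0 j - x 0 j) ^+ 2 by apply: sumr_ge0 => i _; rewrite
    sqr_ge0.
have [yx|/existsNP[j /negP]] := pselect (forall j, `|y 0 j - x 0 j| < d).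
  rewrite (le_trans (dh y Dy yx)) // lerDl mulr_ge0 // divr_ge0 ?mulr_ge0
      ?exprn_ge0 //.
rewrite -leNgt => dj.
have dS : d ^+ 2 <= \sum_j (y 0 j - x 0 j) ^+ 2.
  apply: le_trans (sge j); rewrite -[X in _ <= X]real_normK ?num_real //.
  by rewrite ler_sqr ?nnegrE.
rewrite (@le_trans _ _ (2 * M)) //.
  by rewrite (le_trans (ler_normB _ _)) // mulr_natl mulr2n lerD ?hM.
rewrite (@le_trans _ _ (2 * M / d ^+ 2 * \sum_j (y 0 j - x 0 j) ^+ 2)) //; last
    by rewrite lerDr ltW.
rewrite -mulrA ler_peMr ?mulr_ge0 //.
by rewrite mulrC ler_pdivlMr ?exprn_gt0 // mul1r.
Qed.

(** Variance plus squared bias. The nodes are spaced by 1/(N+1) even when the degree [D] is [N], so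
    the mean misses [x] by (N+1-D)x/(N+1), while the variance is Dx(1-x)/(N+1)^2. *)
Lemma bernstein_moment_le N D (x : R) : (N <= D <= N.+1)%N -> 0 <= x <= 1 ->
  \sum_(k < N.+2) (k%:R / N.+1%:R - x) ^+ 2 * (bernstein D k).[x] <= N.+1%:R^-1.
Proof.
move=> /andP[ND DN] /andP[x0 x1].
have N0 : N.+1%:R != 0 :> R by rewrite pnatr_eq0.
have := @bernstein_moment R D N.+2 (x ^+ 2) (- 2 * x / N.+1%:R) (N.+1%:R ^- 2) x.
rewrite ltnS => /(_ DN) H.
rewrite (eq_bigr (fun k : 'I_N.+2 => (x ^+ 2 + - 2 * x / N.+1%:R * k%:R +
  N.+1%:R ^- 2 * k%:R ^+ 2) * (bernstein D k).[x])); last first.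
  by move=> k _; congr (_ * _); field.
rewrite H.
have -> : x ^+ 2 + - 2 * x / N.+1%:R * (D%:R * x) + N.+1%:R ^- 2 *
    (D%:R * x * (1 - x) + (D%:R * x) ^+ 2) =
  (N.+1%:R ^- 2) * (D%:R * x * (1 - x) + ((N.+1%:R - D%:R) * x) ^+ 2) by field.
rewrite -[leRHS](mulfVK N0) -[X in _ <= X * _]invfM -expr2.
rewrite ler_wpM2l // ?invr_ge0 ?exprn_ge0 //.
have D0 : 0 <= D%:R :> R by [].
have D1 : D%:R <= N.+1%:R :> R by rewrite ler_nat.
have D2 : N.+1%:R - D%:R <= 1 :> R by rewrite lerBlDr -natr1 addrC lerD2l ler_nat.
have x2 : 0 <= x * (1 - x) <= 1 by nra.
set d := D%:R in D0 D1 D2 *; set m := N.+1%:R in D1 D2 *.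
have : d * (x * (1 - x)) <= d * 1 by rewrite ler_wpM2l //; lra.
have : (m - d) ^+ 2 <= m - d by nra.
have : 0 <= x ^+ 2 <= 1 by nra.
nra.
Qed.

End bernstein_average.

Section bernstein_average.
Context {R : realType}.
(* Two uses: xi = the nodes k/(N+1) and D = N+1 for the approximation of u; xi = mean
   value points and D = N in direction i for its i-th partial derivative. *)
Variables (n : nat) (D : nat -> 'I_n -> nat).
Variable xi : forall N, {ffun 'I_n -> 'I_N.+2} -> 'rV[R]_n.
Hypothesis DN : forall N i, (N <= D N i <= N.+1)%N.
Hypothesis xi_cube : forall N (k : {ffun 'I_n -> 'I_N.+2}), closed_cube (xi k).
Hypothesis xi_near : forall N (k : {ffun 'I_n -> 'I_N.+2}) i,
  `|xi k 0 i - (k i)%:R / N.+1%:R| <= N.+1%:R^-1.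

Definition bernstein_average (h : 'rV[R]_n -> R) N x :=
  \sum_(k : {ffun 'I_n -> 'I_N.+2})
    h (xi k) * tensor_poly (fun i => bernstein (D N i) (k i)) x.

Let w N (k : {ffun 'I_n -> 'I_N.+2}) x : R :=
  tensor_poly (fun i => bernstein (D N i) (k i)) x.

Let w_ge0 N (k : {ffun 'I_n -> 'I_N.+2}) x : closed_cube x -> 0 <= w k x.
Proof. by move=> xc; apply: prodr_ge0 => i _; exact: bernstein_ge0. Qed.

Let D_lt N i : (D N i < N.+2)%N.
Proof. by rewrite ltnS; have /andP[] := DN N i. Qed.

Let sum_w N x : \sum_(k : {ffun 'I_n -> 'I_N.+2}) w k x = 1.
Proof.
apply: (@sum_product_weight _ _ _ (fun i (a : 'I_N.+2) => (bernstein (D N i)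
    a).[x 0 i])).
by move=> i; exact: sum_bernstein.
Qed.

Let sum_w_sqr N x : closed_cube x ->
  \sum_(k : {ffun 'I_n -> 'I_N.+2}) (\sum_j (xi k 0 j - x 0 j) ^+ 2) * w k x
  <= 4 * n%:R / N.+1%:R.
Proof.
move=> xc; under eq_bigr do rewrite mulr_suml.
rewrite exchange_big /= -mulrA mulrCA mulr_natl -[n in leRHS]card_ord -sumr_const.
apply: ler_sum => j _.
have N0 : 0 < N.+1%:R^-1 :> R by rewrite invr_gt0.
have N1 : N.+1%:R^-1 <= 1 :> R by rewrite invf_le1 ?ler1n.
set v := N.+1%:R^-1.
have v0 : 0 <= v by exact: ltW.
(* Passage from the sample [a] to the node [b]: (a-c)^2 is at most 2(b-c)^2 + 2(a-b)^2, and (a-b)^2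
   is at most v^2, hence at most v. With the moment bound v this gives 4v per coordinate. *)
apply: (@le_trans _ _ (\sum_(k : {ffun 'I_n -> 'I_N.+2})
    (2 * (((k j)%:R / N.+1%:R - x 0 j) ^+ 2 * w k x) + 2 * v * w k x))).
  apply: ler_sum => k _; have := xi_near k j; have := w_ge0 k xc.
  rewrite -/v ler_norml; set a := xi k 0 j; set b := (k j)%:R / _.
  set c := x 0 j; set W := w k x => W0 /andP[ab1 ab2].
  rewrite [leRHS](_ : _ = (2 * (b - c) ^+ 2 + 2 * v) * W); last by ring.
  rewrite ler_wpM2r //.
  have : (a - b) ^+ 2 <= v ^+ 2.
    by rewrite -[leLHS]real_normK ?num_real // ler_sqr ?nnegrE // ler_norml ab1.
  have : v ^+ 2 <= v by rewrite expr2 ler_piMr.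
  have : 0 <= (a - 2 * b + c) ^+ 2 by exact: sqr_ge0.
  by nra.
rewrite big_split /= -!mulr_sumr sum_w mulr1.
rewrite (sum_product_weight1 (b := fun i (a : 'I_N.+2) => (bernstein (D N i)
    a).[x 0 i])
   _ _ (fun a : 'I_N.+2 => (a%:R / N.+1%:R - x 0 j) ^+ 2)); last first.
  by move=> i; exact: sum_bernstein.
have := bernstein_moment_le (DN N j) (xc j).
by rewrite -/v; lra.
Qed.

Lemma bernstein_average_bounded h M N x : (forall y, closed_cube y -> `|h y| <=
    M) ->
  closed_cube x -> `|bernstein_average h N x| <= M.
Proof.
move=> hM xc; rewrite /bernstein_average (le_trans (ler_norm_sum _ _ _)) //.
rewrite -[M]mulr1 -(sum_w N x) mulr_sumr ler_sum // => k _.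
by rewrite normrM (ger0_norm (w_ge0 k xc)) ler_wpM2r ?w_ge0 ?hM.
Qed.

(** Averaging the majorant of [continuous_within_quadratic] leaves [e / 2] plus [C] times the second
    moment bounded in [sum_w_sqr], which tends to 0. *)
Lemma bernstein_average_cvg h M x : (forall y, closed_cube y -> `|h y| <= M) ->
  closed_cube x -> h y @[y --> within (@closed_cube R n) (nbhs x)] --> h x ->
  bernstein_average h N x @[N --> \oo] --> h x.
Proof.
move=> hM xc hx; apply/cvgrPdist_le => e e0.
have e20 : 0 < e / 2 by rewrite divr_gt0.
have [C C0 hC] := continuous_within_quadratic hx hM xc e20.
(* The [+ 1] keeps the denominator positive when [C] or [n] is 0. *)
have d0 : 0 < e / 2 / (C * (4 * n%:R) + 1).
  by rewrite divr_gt0 // ltr_wpDl // mulr_ge0 // mulr_ge0.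
near=> N.
have : N.+1%:R^-1 < e / 2 / (C * (4 * n%:R) + 1) :> R.
  by near: N; exact: (near_infty_natSinv_lt (PosNum d0)).
rewrite ltr_pdivlMr ?ltr_wpDl ?mulr_ge0 // => Ne.
rewrite distrC -[X in _ - X]mulr1 -(sum_w N x) mulr_sumr -sumrB.
rewrite (le_trans (ler_norm_sum _ _ _)) //.
apply: (@le_trans _ _ (\sum_(k : {ffun 'I_n -> 'I_N.+2})
    (e / 2 * w k x + C * ((\sum_j (xi k 0 j - x 0 j) ^+ 2) * w k x)))).
  apply: ler_sum => k _; rewrite -mulrBl normrM (ger0_norm (w_ge0 k xc)).
  by rewrite mulrA -mulrDl ler_wpM2r ?w_ge0 // hC.
rewrite big_split /= -!mulr_sumr sum_w mulr1.
rewrite [leRHS]splitr lerD2l (le_trans (ler_wpM2l C0 (sum_w_sqr N xc))) //.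
have : 0 <= N.+1%:R^-1 :> R by rewrite invr_ge0.
move: Ne; rewrite [C * (_ / _)]mulrA [_ / N.+1%:R]mulrC mulrDr mulr1 => Ne v0.
by rewrite ltW // (le_lt_trans _ Ne) // lerDl.
Unshelve. all: by end_near. Qed.

End bernstein_average.

(** * Continuity relative to a set *)

Section continuity_on.
Context {R : realType}.

(** Pointwise form of subspace continuity ([subspace_continuousP] passes from one to the other), to
    which the limit rules for sums, products and compositions apply directly. *)
Definition cont_on (V W : topologicalType) (D : set V) (h : V -> W) :=
  forall x, D x -> h y @[y --> within D (nbhs x)] --> h x.

Lemma cont_on_comp (U V W : topologicalType) (D : set U) (E : set V)
    (g : U -> V) (h : V -> W) :
  (forall x, D x -> E (g x)) -> cont_on D g -> cont_on E h ->
  cont_on D (fun x => h (g x)).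
Proof.
move=> DE cg ch x Dx.
have gE : g y @[y --> within D (nbhs x)] --> within E (nbhs (g x)).
  move=> A /= EA; have := cg _ Dx _ EA.
  rewrite /nbhs /= /within /= => H; apply: filterS H => y H Dy.
  by apply: H => //; exact: DE.
exact: cvg_comp gE (ch _ (DE _ Dx)).
Qed.

Lemma continuous_cont_on (V W : topologicalType) (D : set V) (h : V -> W) :
  continuous h -> cont_on D h.
Proof. by move=> ch x Dx; apply: cvg_trans (ch x); exact: cvg_within_filter. Qed.

Lemma cont_onM (V : topologicalType) (D : set V) (g h : V -> R) :
  cont_on D g -> cont_on D h -> cont_on D (fun x => g x * h x).
Proof. by move=> cg ch x Dx; apply: cvgM; [exact: cg|exact: ch]. Qed.

Lemma cont_onD (V : topologicalType) (D : set V) (g h : V -> R) :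
  cont_on D g -> cont_on D h -> cont_on D (fun x => g x + h x).
Proof. by move=> cg ch x Dx; apply: cvgD; [exact: cg|exact: ch]. Qed.

Lemma cont_on_cst (V W : topologicalType) (D : set V) (c : W) :
  cont_on D (fun=> c).
Proof. by move=> x Dx; exact: cvg_cst. Qed.

Lemma cont_on_sum (V : topologicalType) (D : set V) (I : Type) (r : seq I)
    (P : pred I) (g : I -> V -> R) : (forall i, P i -> cont_on D (g i)) ->
  cont_on D (fun x => \sum_(i <- r | P i) g i x).
Proof.
by move=> cg x Dx; apply: (cvg_big add_continuous) => i Pi; exact: cg.
Qed.

Lemma cont_on_prod (V : topologicalType) (D : set V) (I : Type) (r : seq I)
    (P : pred I) (g : I -> V -> R) : (forall i, P i -> cont_on D (g i)) ->
  cont_on D (fun x => \prod_(i <- r | P i) g i x).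
Proof.
by move=> cg x Dx; apply: (cvg_big (@mul_continuous R)) => i Pi; exact: cg.
Qed.

Lemma cont_on_det (V : topologicalType) (D : set V) n (A : V -> 'M[R]_n) :
  (forall i j, cont_on D (fun x => A x i j)) -> cont_on D (fun x => \det (A x)).
Proof.
move=> cA; apply: cont_on_sum => s _; apply: cont_onM; first exact: cont_on_cst.
by apply: cont_on_prod => i _; exact: cA.
Qed.

Lemma compact_cont_on_bounded (V : topologicalType) (D : set V) (h : V -> R) :
  compact D -> cont_on D h -> exists M : R, forall x, D x -> `|h x| <= M.
Proof.
move=> cD /subspace_continuousP ch.
have /compact_bounded[M [_ hM]] := continuous_compact ch cD.
exists (M + 1) => x Dx; apply: (hM (M + 1)); first by rewrite ltrDl.
by exists x.
Qed.

Lemma compact_closed_cube n : compact (@closed_cube R n).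
Proof.
have := @rV_compact R n (fun=> `[0, 1]%classic) (fun=> @segment_compact R 0 1).
congr compact; apply/seteqP; split=> x /= xc i; have := xc i; rewrite in_itv
    /=; by [].
Qed.

End continuity_on.

(** * Partial derivatives on the closed cube *)

Section C1_cube.
Context {R : realType}.

(** In direction [i] only coordinate [i] has to be interior: Bernstein nodes lie on the faces too,
    and the mean value theorem is applied along segments joining them. *)
Definition C1_cube n (u : 'rV[R]_n -> R) (du : 'I_n -> 'rV[R]_n -> R) :=
  [/\ cont_on (@closed_cube R n) u,
      forall i, cont_on (@closed_cube R n) (du i) &
      forall i x, closed_cube x -> 0 < x 0 i < 1 ->
        is_derive x (delta_mx 0 i) u (du i x)].

Lemma rV_shift_continuous n (x v : 'rV[R]_n) : continuous (fun r : R => x + r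
    *: v).
Proof.
move=> r; apply: cvgD; first exact: cvg_cst.
by apply: cvgZr_tmp; exact: cvg_id.
Qed.

Lemma C1_cube_mvt n (u : 'rV[R]_n -> R) du i x t : C1_cube u du -> 0 < t ->
  closed_cube x -> closed_cube (x + t *: delta_mx 0 i) ->
  exists r, [/\ 0 < r < t, closed_cube (x + r *: delta_mx 0 i) &
    u (x + t *: delta_mx 0 i) - u x = t * du i (x + r *: delta_mx 0 i)].
Proof.
move=> [cu _ du_] t0 xc xtc.
have coord r j : (x + r *: delta_mx 0 i) 0 j = x 0 j + r * (j == i)%:R :> R.
  by rewrite !mxE eqxx.
have seg r : 0 <= r <= t -> closed_cube (x + r *: delta_mx 0 i).
  move=> /andP[r0 rt] j; rewrite coord.
  have := xc j; have := xtc j; rewrite coord.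
  by case: (j == i) => /=; lra.
pose g r := u (x + r *: delta_mx 0 i).
have [r rt E] : exists2 r, r \in `]0, t[ &
    g t - g 0 = du i (x + r *: delta_mx 0 i) * (t - 0).
  apply: (@MVT R g) => //.
  - move=> r; rewrite in_itv /= => /andP[r0 rt].
    have rc : closed_cube (x + r *: delta_mx 0 i) by apply: seg; rewrite !ltW.
    have ri : 0 < (x + r *: delta_mx 0 i) 0 i < 1.
      rewrite coord eqxx mulr1; have := xc i; have := xtc i.
      by rewrite coord eqxx mulr1; lra.
    have [d1 d2] := du_ i _ rc ri.
    have E : (fun h : R => h^-1 *: ((g \o shift r) (h *: 1) - g r)) =
       (fun h : R => h^-1 *: ((u \o shift (x + r *: delta_mx 0 i)) (h *:
           delta_mx 0 i)
          - u (x + r *: delta_mx 0 i))).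
      apply/funext => h; rewrite /g /= /shift /=; congr (_ *: (u _ - _)).
      by rewrite [h *: 1]mulr1 scalerDl addrCA.
    by split; rewrite /derivable /derive E.
  - apply/subspace_continuousP; apply: (@cont_on_comp _ _ _ _ (@closed_cube R n)).
    + by move=> y /=; rewrite in_itv /=; exact: seg.
    + by apply: continuous_cont_on; exact: rV_shift_continuous.
    + exact: cu.
move: rt; rewrite in_itv /= => /andP[r0 rt].
exists r; split; first by rewrite r0.
  by apply: seg; rewrite !ltW.
by move: E; rewrite /g scale0r addr0 subr0 mulrC.
Qed.

End C1_cube.

Section bernstein_approximation.
Context {R : realType}.
Variable n : nat.

Definition bernstein_node N (k : {ffun 'I_n -> 'I_N.+2}) : 'rV[R]_n :=
  \row_i ((k i)%:R / N.+1%:R).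

Lemma bernstein_node_cube N (k : {ffun 'I_n -> 'I_N.+2}) : closed_cube
    (bernstein_node k).
Proof.
move=> i; rewrite mxE divr_ge0 //= ler_pdivrMr ?ltr0n // mul1r ler_nat.
by rewrite -ltnS.
Qed.

Definition bernstein_approx (u : 'rV[R]_n -> R) N x :=
  bernstein_average (fun N _ => N.+1) bernstein_node u N x.

Lemma bernstein_approx_cvg (u : 'rV[R]_n -> R) : cont_on (@closed_cube R n) u ->
  bounded_cvg (@closed_cube R n) (bernstein_approx u) u.
Proof.
move=> cu; have [M uM] := compact_cont_on_bounded (@compact_closed_cube R n) cu.
have DN N (i : 'I_n) : (N <= N.+1 <= N.+1)%N by rewrite leqnSn leqnn.
split.
  by exists M => N x xc; apply: bernstein_average_bounded => // N' k; exact: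
      bernstein_node_cube.
move=> x xc; apply: (bernstein_average_cvg _ _ _ uM) => //.
- by move=> N k; exact: bernstein_node_cube.
- by move=> N k i; rewrite mxE subrr normr0 invr_ge0.
- exact: cu.
Qed.

Lemma bernstein_approx_measurable u N : cube_measurable (bernstein_approx u N).
Proof.
apply: cube_measurable_sum => k _; apply: measurable_funM; first exact:
    measurable_cst.
exact: tensor_poly_measurable.
Qed.

Lemma bounded_cvg_open (g_ : nat -> 'rV[R]_n -> R) (g : 'rV[R]_n -> R) :
  bounded_cvg (@closed_cube R n) g_ g -> bounded_cvg (@open_cube R n) g_ g.
Proof.
move=> [[M gM] gg]; split; last by move=> x /open_closed_cube; exact: gg.
by exists M => N x /open_closed_cube; exact: gM.
Qed.

(** Bernstein polynomials are measurable in the tuple coordinates, hence so is their pointwise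
    limit; the topology of row vectors is not compared with the sigma-algebra of tuples. *)
Lemma cont_on_cube_measurable (u : 'rV[R]_n -> R) :
  cont_on (@closed_cube R n) u -> cube_measurable u.
Proof.
move=> cu; have [_ uu] := bernstein_approx_cvg cu.
apply: (@measurable_fun_cvg _ _ _ _ (fun N y => bernstein_approx u N
    (@tuple_row R n y))).
  by move=> N; exact: bernstein_approx_measurable.
by move=> y /open_closed_cube yc; exact: uu.
Qed.

Lemma cont_on_cube_bounded (u : 'rV[R]_n -> R) :
  cont_on (@closed_cube R n) u -> cube_bounded u.
Proof.
move=> cu; have [M uM] := compact_cont_on_bounded (@compact_closed_cube R n) cu.
by exists M => x /open_closed_cube; exact: uM.
Qed.

(* The i-th partial derivative of bernstein_approx u N, written out. *)
Definition dbernstein_approx (u : 'rV[R]_n -> R) i N x :=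
  \sum_(k : {ffun 'I_n -> 'I_N.+2})
    u (bernstein_node k) * tensor_poly (fun i' => deriv_if (i == i') (bernstein
        N.+1 (k i'))) x.

(* ordS is cyclic; the wrap-around from N+1 to 0 is harmless because
   bernstein N N.+1 = 0, and it makes the shift bijective. *)
Let node_shift N i (k : {ffun 'I_n -> 'I_N.+2}) : {ffun 'I_n -> 'I_N.+2} :=
  [ffun i' => if i' == i then ordS (k i') else k i'].

Let node_shift_inj N i : injective (@node_shift N i).
Proof.
move=> k k' /ffunP E; apply/ffunP => j; have := E j; rewrite !ffunE.
by case: eqP => // _; exact: ordS_inj.
Qed.

Let node_shiftE N i (k : {ffun 'I_n -> 'I_N.+2}) : (k i < N.+1)%N ->
  bernstein_node (node_shift i k) = bernstein_node k + N.+1%:R^-1 *: delta_mx 0 i.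
Proof.
move=> ki; apply/rowP => j; rewrite !mxE ffunE eqxx /=.
case: eqVneq => [->|ji]; rewrite ?mulr0 ?addr0 //=.
by rewrite modn_small ?ltnS // -natr1 mulrDl mul1r mulr1.
Qed.

(** Summation by parts: [deriv_bernstein] puts a difference of neighbouring indices on the weights,
    and the shift in direction [i] moves it onto the values of [u]. The degree drops to [N] in
    direction [i] only. *)
Let dbernsteinE u i N x : dbernstein_approx u i N x =
  \sum_(k : {ffun 'I_n -> 'I_N.+2})
    N.+1%:R * (u (bernstein_node (node_shift i k)) - u (bernstein_node k)) *
      tensor_poly (fun i' => bernstein (if i' == i then N else N.+1) (k i')) x.
Proof.
pose W N (k : {ffun 'I_n -> 'I_N.+2}) := \prod_(j | j != i) (bernstein N.+1 (k
    j)).[x 0 j].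
pose G p (k : {ffun 'I_n -> 'I_N.+2}) :=
  u (bernstein_node k) * (N.+1%:R * (p N (k i)).[x 0 i] * W N k).
transitivity (\sum_k (G bernstein_pred k - G bernstein k)).
  apply: eq_bigr => k _; rewrite /G -mulrBr /tensor_poly (bigD1 i) //= eqxx /=.
  rewrite deriv_bernstein hornerZ hornerD hornerN.
  rewrite (eq_bigr (fun j => (bernstein N.+1 (k j)).[x 0 j])); last first.
    by move=> j /negbTE ji; rewrite eq_sym ji.
  by rewrite -/(W N k); ring.
rewrite sumrB (reindex_inj (@node_shift_inj N i)) /= -sumrB.
apply: eq_bigr => k _; rewrite /G.
have -> : W N (node_shift i k) = W N k.
  by apply: eq_bigr => j /negbTE ji; rewrite ffunE ji.
rewrite /tensor_poly [in RHS](bigD1 i) //= eqxx.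
rewrite [in RHS](eq_bigr (fun j => (bernstein N.+1 (k j)).[x 0 j])); last first.
  by move=> j /negbTE ->.
rewrite -/(W N k) ffunE eqxx.
have -> : bernstein_pred N (ordS (k i)) = bernstein N (k i) :> {poly R}.
  have := ltn_ord (k i); rewrite ltnS leq_eqVlt => /orP[/eqP kN|kN].
    by rewrite /= kN modnn /= bernstein_eq0.
  by rewrite /= modn_small.
ring.
Qed.

(** Each difference quotient in [dbernsteinE] is a value of [du i] between two neighbouring nodes,
    so the derivative is a [bernstein_average] of [du i]. *)
Lemma dbernstein_approx_cvg (u : 'rV[R]_n -> R) du i : C1_cube u du ->
  bounded_cvg (@closed_cube R n) (dbernstein_approx u i) (du i).
Proof.
move=> C1u; have [_ cdu _] := C1u.
have [M duM] := compact_cont_on_bounded (@compact_closed_cube R n) (cdu i).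
pose D N (j : 'I_n) := if j == i then N else N.+1.
have DN N j : (N <= D N j <= N.+1)%N by rewrite /D; case: ifP; rewrite leqnSn
    leqnn.
have xiP N (k : {ffun 'I_n -> 'I_N.+2}) : exists xi : 'rV[R]_n,
  [/\ closed_cube xi, forall j, `|xi 0 j - (k j)%:R / N.+1%:R| <= N.+1%:R^-1 &
   (k i < N.+1)%N ->
     N.+1%:R * (u (bernstein_node (node_shift i k)) - u (bernstein_node k)) =
         du i xi].
  have [ki|ki] := ltnP (k i) N.+1; last first.
    (* The last index has no right neighbour. Its weight [bernstein N N.+1] is 0, so any sample near
       the node will do. *)
    exists (bernstein_node k); split=> //; first exact: bernstein_node_cube.
    by move=> j; rewrite mxE subrr normr0 invr_ge0.
  have N0 : 0 < N.+1%:R^-1 :> R by rewrite invr_gt0.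
  have := @C1_cube_mvt _ _ _ _ i _ _ C1u N0 (bernstein_node_cube k).
  rewrite -node_shiftE // => /(_ (bernstein_node_cube _))[r [/andP[r0 rN] rc E]].
  exists (bernstein_node k + r *: delta_mx 0 i); split=> // [j|_].
    rewrite !mxE eqxx /= addrAC subrr add0r.
    by case: (j == i); rewrite ?mulr1 ?mulr0 ?normr0 ?ltW // gtr0_norm.
  by rewrite E mulrA divff ?mul1r // pnatr_eq0.
pose xi N k := projT1 (cid (xiP N k)).
have xi_cube N k : closed_cube (xi N k) by rewrite /xi; case: cid => ? [].
have xi_near N k j : `|xi N k 0 j - (k j)%:R / N.+1%:R| <= N.+1%:R^-1.
  by rewrite /xi; case: cid => ? [].
have E N x : dbernstein_approx u i N x = bernstein_average D xi (du i) N x.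
  rewrite dbernsteinE; apply: eq_bigr => k _.
  have [ki|ki] := ltnP (k i) N.+1.
    by congr (_ * _); rewrite /xi; case: cid => ? [_ _] /= ->.
  by rewrite /tensor_poly (bigD1 i) //= /D eqxx /= bernstein_eq0 //
    horner0 !mul0r !mulr0.
split.
  by exists M => N x xc; rewrite E; exact: bernstein_average_bounded.
move=> x xc; under eq_fun do rewrite E.
by apply: bernstein_average_cvg duM _ _ => //; exact: cdu.
Qed.

End bernstein_approximation.

(** * Stokes' formula for C^1 functions *)

Section stokes.
Context {R : realType}.

Lemma face_point_closed n (i : 'I_n.+1) (s : bool) (y : 'rV[R]_n) :
  closed_cube y -> closed_cube (face_point i s y).
Proof.
move=> yc k; rewrite mxE; case: unliftP => [j _|_]; first exact: yc.
by case: s; rewrite lexx ler01.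
Qed.

Lemma cvg_rV (T : Type) (F : set_system T) n (g : T -> 'rV[R]_n) (l : 'rV[R]_n) :
  Filter F -> (forall j, g x 0 j @[x --> F] --> l 0 j) -> g x @[x --> F] --> l.
Proof.
move=> FF gl; apply/cvg_ballP => e e0.
have : \forall x \near F, forall j, ball (l 0 j) e (g x 0 j).
  by apply: filter_forall => j; exact: (cvg_ball (gl j)).
by apply: filterS => x H; split=> // i j; rewrite ord1.
Qed.

Lemma coord_cvg n (x : 'rV[R]_n) j : (fun y : 'rV[R]_n => y 0 j) @ x --> x 0 j.
Proof. exact: coord_continuous. Qed.

Lemma face_point_continuous n (i : 'I_n.+1) (s : bool) :
  continuous (face_point (R := R) i s).
Proof.
move=> y; apply: (@cvg_rV _ (nbhs y) _ _ _ (nbhs_filter y)) => k.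
rewrite mxE.
under eq_fun do rewrite mxE.
by case: unliftP => [j _|_]; [exact: (@coord_cvg _ y j)|exact: cvg_cst].
Qed.

(** The orientation sign of face [i] is not included: it is carried by the permutation signs in
    [stokes_perm] and by the cofactors in [stokes_det]. *)
Definition boundary n (i : 'I_n.+1) (h : 'rV[R]_n.+1 -> R) : R :=
  int_cube (fun y : 'rV_n => h (face_point i true y)) -
  int_cube (fun y : 'rV_n => h (face_point i false y)).

Lemma bounded_cvg_prod n (D : set 'rV[R]_n) (I : finType)
    (g_ : I -> nat -> 'rV[R]_n -> R) (g : I -> 'rV[R]_n -> R) :
  (forall i, bounded_cvg D (g_ i) (g i)) ->
  bounded_cvg D (fun N x => \prod_i g_ i N x) (fun x => \prod_i g i x).
Proof.
move=> gg; have /choice[M hM] i := (gg i).1; split.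
  exists (\prod_i M i) => N x xD; rewrite normr_prod.
  by apply: ler_prod => i _; rewrite normr_ge0 hM.
by move=> x xD; apply: (cvg_big (@mul_continuous R)) => i _; exact: (gg i).2.
Qed.

Lemma bounded_cvg_face n (i : 'I_n.+1) s (g_ : nat -> 'rV[R]_n.+1 -> R) g :
  bounded_cvg (@closed_cube R n.+1) g_ g ->
  bounded_cvg (@closed_cube R n) (fun N y => g_ N (face_point i s y))
    (fun y => g (face_point i s y)).
Proof.
move=> [[M gM] gg]; split; first by exists M => N x xc;
    exact/gM/face_point_closed.
by move=> x xc; exact/gg/face_point_closed.
Qed.

Definition tensor_sum n (K : finType) (c : K -> R) (q : K -> 'I_n -> {poly R})
    (x : 'rV[R]_n) := \sum_k c k * tensor_poly (q k) x.

Lemma cube_measurableM n (g h : 'rV[R]_n -> R) :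
  cube_measurable g -> cube_measurable h -> cube_measurable (fun x => g x * h x).
Proof. exact: measurable_funM. Qed.

Lemma tensor_sum_measurable n (K : finType) (c : K -> R) (q : K -> 'I_n ->
    {poly R}) :
  cube_measurable (tensor_sum c q).
Proof.
apply: cube_measurable_sum => k _.
by apply: cube_measurableM; [exact: measurable_cst|exact: tensor_poly_measurable].
Qed.

Lemma int_cube_tensor_sum n (K : finType) (c : K -> R) (q : K -> 'I_n -> {poly
    R}) :
  int_cube (tensor_sum c q) = \sum_k c k * \prod_i poly_int01 (q k i).
Proof.
rewrite /tensor_sum int_cube_sum => [|k _|k _].
- by apply: eq_bigr => k _; rewrite int_cubeZ ?int_cube_tensor_poly //;
    [exact: tensor_poly_measurable|exact: tensor_poly_cube_bounded].
- by apply: cube_measurableM; [exact: measurable_cst|exact: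
    tensor_poly_measurable].
- by apply: cube_boundedM; [exact: cube_bounded_cst|exact:
    tensor_poly_cube_bounded].
Qed.

Lemma tensor_sum_face n (K : finType) (c : K -> R) (q : K -> 'I_n.+1 -> {poly R})
   (i : 'I_n.+1) (s : bool) y :
  tensor_sum c q (face_point i s y) =
  tensor_sum (fun k => c k * (q k i).[s%:R]) (fun k j => q k (lift i j)) y.
Proof. by apply: eq_bigr => k _; rewrite tensor_poly_face mulrA. Qed.

Lemma boundary_tensor_sum n (K : finType) (c : K -> R)
    (q : K -> 'I_n.+1 -> {poly R}) (i : 'I_n.+1) :
  boundary i (tensor_sum c q) =
  \sum_k c k * (((q k i).[1] - (q k i).[0]) * \prod_l poly_int01 (q k (lift i
      l))).
Proof.
rewrite /boundary.
under eq_int_cube do rewrite tensor_sum_face.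
under [X in _ - X]eq_int_cube do rewrite tensor_sum_face.
rewrite !int_cube_tensor_sum -sumrB; apply: eq_bigr => k _ /=; ring.
Qed.

Lemma boundary_cvg n (i : 'I_n.+1) (K : nat -> finType) (c : forall N, K N -> R)
    (q : forall N, K N -> 'I_n.+1 -> {poly R}) (g : 'rV[R]_n.+1 -> R) :
  bounded_cvg (@closed_cube R n.+1) (fun N => tensor_sum (@c N) (@q N)) g ->
  boundary i (tensor_sum (@c N) (@q N)) @[N --> \oo] --> boundary i g.
Proof.
move=> gg; have mf s N : cube_measurable (fun y : 'rV[R]_n => tensor_sum (@c N)
    (@q N) (face_point i s y)).
  under eq_fun do rewrite tensor_sum_face.
  exact: tensor_sum_measurable.
apply: cvgB; apply: int_cube_cvg => //.
all: exact: (bounded_cvg_open (bounded_cvg_face i _ gg)).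
Qed.

Variables (n : nat) (u : 'I_n.+1 -> 'rV[R]_n.+1 -> R).
Variable du : 'I_n.+1 -> 'I_n.+1 -> 'rV[R]_n.+1 -> R.
Hypothesis C1u : forall j, C1_cube (u j) (du j).

(** With [b] false the index [i] is inert, so one family covers the undifferentiated row [0] and the
    differentiated rows. *)
Let A N j (b : bool) i : 'rV[R]_n.+1 -> R :=
  tensor_sum (fun k : {ffun 'I_n.+1 -> 'I_N.+2} => u j (bernstein_node k))
    (fun k i' => deriv_if (b && (i == i')) (bernstein N.+1 (k i'))).

Let A_cvg j (b : bool) i : bounded_cvg (@closed_cube R n.+1)
  (fun N => A N j b i) (if b then du j i else u j).
Proof.
case: b; first exact: (dbernstein_approx_cvg _ (C1u j)).
by apply: bernstein_approx_cvg; have [] := C1u j.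
Qed.

Let A_prod N (b : 'I_n.+1 -> bool) (s : 'I_n.+1 -> 'I_n.+1) x :
  \prod_j A N j (b j) (s j) x =
  tensor_sum (fun k : {ffun 'I_n.+1 -> {ffun 'I_n.+1 -> 'I_N.+2}} =>
      \prod_j u j (bernstein_node (k j)))
    (fun k i => \prod_j deriv_if (b j && (s j == i)) (bernstein N.+1 (k j i))) x.
Proof.
rewrite /A /tensor_sum bigA_distr_bigA; apply: eq_bigr => k _.
by rewrite big_split /= tensor_poly_prod.
Qed.

(** For each [N] both sides expand by multilinearity into the same combination of instances of
    [stokes_poly], one for each choice of a node per row; bounded convergence then passes both sides
    to the limit. *)
Lemma stokes_perm :
  \sum_(s : 'S_n.+1) (-1) ^+ odd_perm s *
    boundary (s ord0) (fun x => u ord0 x * \prod_(j | j != ord0) du j (s j) x)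
  = \sum_(s : 'S_n.+1) (-1) ^+ odd_perm s * int_cube (fun x => \prod_j du j (s
      j) x).
Proof.
pose B N (b : 'I_n.+1 -> bool) (s : 'S_n.+1) := tensor_sum
  (fun k : {ffun 'I_n.+1 -> {ffun 'I_n.+1 -> 'I_N.+2}} => \prod_j u j
      (bernstein_node (k j)))
  (fun k i => \prod_j deriv_if (b j && (s j == i)) (bernstein N.+1 (k j i))).
have BE N b (s : 'S_n.+1) : B N b s = (fun x => \prod_j A N j (b j) (s j) x).
  by apply/funext => x; rewrite A_prod.
have Bcvg b (s : 'S_n.+1) : bounded_cvg (@closed_cube R n.+1) (fun N => B N b s)
    (fun x => \prod_j (if b j then du j (s j) else u j) x).
  under eq_fun do rewrite BE; apply: bounded_cvg_prod => j; exact: A_cvg.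
pose b0 (j : 'I_n.+1) := j != ord0.
pose b1 (j : 'I_n.+1) := true.
have L1 : \sum_(s : 'S_n.+1) (-1) ^+ odd_perm s * boundary (s ord0) (B N b0 s)
    @[N --> \oo] --> \sum_(s : 'S_n.+1) (-1) ^+ odd_perm s *
    boundary (s ord0) (fun x => u ord0 x * \prod_(j | j != ord0) du j (s j) x).
  apply: (cvg_big add_continuous) => s _; apply: cvgM; first exact: cvg_cst.
  apply: boundary_cvg; have := Bcvg b0 s; congr bounded_cvg.
  apply/funext => x; rewrite (bigD1 ord0) //= /b0 ?eqxx /=; congr (_ * _).
  by apply: eq_bigr => j ->.
have L2 : \sum_(s : 'S_n.+1) (-1) ^+ odd_perm s * int_cube (B N b1 s)
    @[N --> \oo] --> \sum_(s : 'S_n.+1) (-1) ^+ odd_perm s *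
    int_cube (fun x => \prod_j du j (s j) x).
  apply: (cvg_big add_continuous) => s _; apply: cvgM; first exact: cvg_cst.
  apply: int_cube_cvg; first by move=> N; exact: tensor_sum_measurable.
  exact/bounded_cvg_open/Bcvg.
have E N : \sum_(s : 'S_n.+1) (-1) ^+ odd_perm s * boundary (s ord0) (B N b0 s) =
   \sum_(s : 'S_n.+1) (-1) ^+ odd_perm s * int_cube (B N b1 s).
  under eq_bigr do rewrite boundary_tensor_sum mulr_sumr.
  under [RHS]eq_bigr do rewrite int_cube_tensor_sum mulr_sumr.
  rewrite exchange_big [RHS]exchange_big; apply: eq_bigr => k _ /=.
  under eq_bigr do rewrite mulrCA.
  under [RHS]eq_bigr do rewrite mulrCA.
  rewrite -!mulr_sumr; congr (_ * _).
  exact: (stokes_poly (fun j i => bernstein N.+1 (k j i))).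
rewrite (funext E) in L1; exact: (cvg_unique _ L1 L2).
Qed.

Lemma boundary_sum (I : finType) (P : pred I) i (g : I -> 'rV[R]_n.+1 -> R) :
  (forall k, cont_on (@closed_cube R n.+1) (g k)) ->
  boundary i (fun x => \sum_(k | P k) g k x) = \sum_(k | P k) boundary i (g k).
Proof.
move=> cg; have cf s k : cont_on (@closed_cube R n) (fun y => g k (face_point i
    s y)).
  apply: cont_on_comp (cg k); first by move=> x; exact: face_point_closed.
  by apply: continuous_cont_on; exact: face_point_continuous.
rewrite /boundary !int_cube_sum ?sumrB // => k _.
all: first [exact: cont_on_cube_measurable | exact: cont_on_cube_bounded].
Qed.

End stokes.

Section stokes_det.
Context {R : realType}.

Lemma cont_on_face n (i : 'I_n.+1) s (g : 'rV[R]_n.+1 -> R) :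
  cont_on (@closed_cube R n.+1) g ->
  cont_on (@closed_cube R n) (fun y => g (face_point i s y)).
Proof.
move=> cg; apply: cont_on_comp cg; first by move=> x; exact: face_point_closed.
by apply: continuous_cont_on; exact: face_point_continuous.
Qed.

Lemma int_cubeZ_cont n c (g : 'rV[R]_n -> R) : cont_on (@closed_cube R n) g ->
  int_cube (fun x => c * g x) = c * int_cube g.
Proof.
move=> cg; apply: int_cubeZ.
  exact: cont_on_cube_measurable.
exact: cont_on_cube_bounded.
Qed.

Lemma boundaryZ n (i : 'I_n.+1) c (g : 'rV[R]_n.+1 -> R) :
  cont_on (@closed_cube R n.+1) g ->
  boundary i (fun x => c * g x) = c * boundary i g.
Proof.
by move=> cg; rewrite /boundary !int_cubeZ_cont -?mulrBr //; exact: cont_on_face.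
Qed.

Lemma eq_boundary n (i : 'I_n.+1) (g h : 'rV[R]_n.+1 -> R) :
  (forall x, closed_cube x -> g x = h x) -> boundary i g = boundary i h.
Proof.
move=> gh; congr (_ - _); apply: eq_int_cube => x /open_closed_cube xc.
all: exact/gh/face_point_closed.
Qed.

(* The determinant with first row replaced by e_i is the cofactor of (0, i), the
   coefficient of u_0 du_1 /\ ... /\ du_n on the face orthogonal to e_i. *)
Lemma stokes_det n (u : 'I_n.+1 -> 'rV[R]_n.+1 -> R)
    (du : 'I_n.+1 -> 'I_n.+1 -> 'rV[R]_n.+1 -> R) :
  (forall j, C1_cube (u j) (du j)) ->
  \sum_i boundary i (fun x => u ord0 x *
     \det (\matrix_(j, l) if j == ord0 then (l == i)%:R else du j l x)) =
  int_cube (fun x => \det (\matrix_(j, l) du j l x)).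
Proof.
move=> C1u.
have cu : cont_on (@closed_cube R n.+1) (u ord0) by have [] := C1u ord0.
have cdu j i : cont_on (@closed_cube R n.+1) (du j i).
  by have [_ + _] := C1u j; exact.
have cp s (P : pred 'I_n.+1) : cont_on (@closed_cube R n.+1) (fun x => \prod_(j
    | P j) du j (s j) x).
  by apply: cont_on_prod => j _; exact: cdu.
have cup s (P : pred 'I_n.+1) : cont_on (@closed_cube R n.+1) (fun x => u ord0
    x * \prod_(j | P j) du j (s j) x).
  exact: cont_onM.
transitivity (\sum_(s : 'S_n.+1) (-1) ^+ odd_perm s * int_cube (fun x =>
    \prod_j du j (s j) x)); last first.
  rewrite (@eq_int_cube _ _ _ (fun x => \sum_(s : 'S_n.+1) (-1) ^+ odd_perm s *
      \prod_j du j (s j) x)); last first.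
    by move=> x _; apply: eq_bigr => s _; congr (_ * _); apply: eq_bigr => j _;
        rewrite mxE.
  have cs (s : 'S_n.+1) : cont_on (@closed_cube R n.+1)
      (fun x => (-1) ^+ odd_perm s * \prod_j du j (s j) x).
    by apply: cont_onM => //; exact: cont_on_cst.
  rewrite int_cube_sum => [|s _|s _].
  - by apply: eq_bigr => s _; rewrite int_cubeZ_cont.
  - exact: cont_on_cube_measurable.
  - exact: cont_on_cube_bounded.
rewrite -(stokes_perm C1u).
(* Row [0] being a unit vector, the Leibniz expansion keeps the permutations with [s ord0 = i]; over
   all [i], each permutation occurs once. *)
transitivity (\sum_i \sum_(s : 'S_n.+1) (s ord0 == i)%:R * ((-1) ^+ odd_perm s *
    boundary i (fun x => u ord0 x * \prod_(j | j != ord0) du j (s j) x))).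
  apply: eq_bigr => i _.
  transitivity (boundary i (fun x => \sum_(s : 'S_n.+1)
     ((s ord0 == i)%:R * (-1) ^+ odd_perm s) *
        (u ord0 x * \prod_(j | j != ord0) du j (s j) x))).
    apply: eq_boundary => x _; rewrite mulr_sumr; apply: eq_bigr => s _.
    rewrite (bigD1 ord0) //= mxE eqxx.
    rewrite (eq_bigr (fun j => du j (s j) x)); last first.
      by move=> j /negbTE j0; rewrite mxE j0.
    rewrite mulrCA [in LHS](mulrCA (u ord0 x)) mulrA; congr (_ * _).
    by rewrite mulrC.
  rewrite boundary_sum => [|s]; last first.
    by apply: cont_onM; [exact: cont_on_cst|exact: cup].
  by apply: eq_bigr => s _; rewrite boundaryZ // mulrA.
rewrite exchange_big; apply: eq_bigr => s _ /=.
rewrite (bigD1 (s ord0)) //= eqxx mul1r big1 ?addr0 // => i /negbTE.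
by rewrite eq_sym => ->; rewrite mul0r.
Qed.

End stokes_det.

(** * Differentials relative to a set *)

Section frechet.
Context {R : realType}.

Definition has_diff_in (V W : normedModType R) (D : set V) (F : V -> W) x
    (L : V -> W) :=
  forall e, 0 < e -> \forall y \near within D (nbhs x),
    `|F y - F x - L (y - x)| <= e * `|y - x|.

(** The remainder times [k h] is at most [d] times the norm of [k h *: (c h - x)], itself eventually
    at most the norm of [v] plus 1. The filter, [c] and [k] are free so as to cover directional
    derivatives, one-sided time derivatives, composition with [f] and, for [k = 1] and [v = 0],
    continuity. *)
Lemma frechet_chain (V W : normedModType R) (D : set V) (F : V -> W) (x : V)
    (L : {linear V -> W}) (T : Type) (G : set_system T) (k : T -> R)
    (c : T -> V) (v : V) : Filter G ->
  has_diff_in D F x L -> continuous L ->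
  (\forall h \near G, D (c h)) -> c h @[h --> G] --> x ->
  k h *: (c h - x) @[h --> G] --> v ->
  k h *: (F (c h) - F x) @[h --> G] --> L v.
Proof.
move=> FG dF cL Dc cx kc.
have E h : k h *: (F (c h) - F x) =
    k h *: (F (c h) - F x - L (c h - x)) + L (k h *: (c h - x)).
  by rewrite linearZ -scalerDr subrK.
rewrite (funext E) -[L v]add0r; apply: cvgD; last exact: cvg_comp kc (cL v).
apply/cvgr0Pnorm_le => e e0.
have M0 : 0 < `|v| + 1 by rewrite ltr_wpDl.
have [d d0 de] : exists2 d, 0 < d & d * (`|v| + 1) <= e.
  by exists (e / (`|v| + 1)); rewrite ?divr_gt0 // divfK ?gt_eqF.
have kM : \forall h \near G, `|k h *: (c h - x)| <= `|v| + 1.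
  by move/cvg_norm : kc => /cvgr_le; apply; rewrite ltrDl.
have Fd : \forall h \near G,
    `|F (c h) - F x - L (c h - x)| <= d * `|c h - x|.
  have := dF d d0; rewrite near_withinE => H; have := cx _ H => /= H'.
  by move: Dc H'; rewrite /nbhs /=; apply: filterS2 => h Dh; apply.
apply: filterS2 kM Fd => h kh Fh.
rewrite normrZ (le_trans (ler_wpM2l (normr_ge0 _) Fh)) // mulrCA.
by rewrite -normrZ (le_trans (ler_wpM2l (ltW d0) kh)).
Qed.

Lemma has_diff_in_cont (V W : normedModType R) (D : set V) (F : V -> W) (x : V)
    (L : {linear V -> W}) : has_diff_in D F x L -> continuous L -> D x ->
  F y @[y --> within D (nbhs x)] --> F x.
Proof.
move=> dF cL Dx.
have cx : (y : V) @[y --> within D (nbhs x)] --> x by exact: cvg_within.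
have : 1 *: (F y - F x) @[y --> within D (nbhs x)] --> L 0.
  apply: (@frechet_chain _ _ _ _ _ _ _ (within D (nbhs x)) (fun=> 1) id 0 _ dF
      cL) => //.
  - by apply: withinT.
  - under eq_fun do rewrite scale1r.
    by rewrite -(subrr x); apply: cvgB => //; exact: cvg_cst.
under eq_fun do rewrite scale1r.
by rewrite linear0 => /subr_cvg0.
Qed.

Lemma row_sum_deltaR m (v : 'rV[R]_m * R) :
  v = \sum_i v.1 0 i *: (delta_mx 0 i, 0) + v.2 *: (0, 1).
Proof.
have E1 : (\sum_i v.1 0 i *: ((delta_mx 0 i : 'rV[R]_m), (0 : R))).1 = v.1.
  rewrite [v.1 in RHS]row_sum_delta.
  exact: (big_morph (fun p : 'rV[R]_m * R => p.1) (fun _ _ => erefl) erefl).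
have E2 : (\sum_i v.1 0 i *: ((delta_mx 0 i : 'rV[R]_m), (0 : R))).2 = 0.
  rewrite (big_morph (fun p : 'rV[R]_m * R => p.2) (fun _ _ => erefl) erefl) /=.
  by rewrite big1 // => i _; rewrite scaler0.
rewrite [LHS]surjective_pairing; congr pair => /=.
  by rewrite E1 scaler0 addr0.
by rewrite E2 add0r [RHS]mulr1.
Qed.

Lemma linear_rVR (W : normedModType R) m (L : {linear ('rV[R]_m * R)%type ->
    W}) v :
  L v = \sum_i v.1 0 i *: L (delta_mx 0 i, 0) + v.2 *: L (0, 1).
Proof.
rewrite {1}[v]row_sum_deltaR linearD linear_sum linearZ; congr (_ + _).
by apply: eq_bigr => i _; rewrite linearZ.
Qed.

(** By expansion on a basis. This supplies the continuity of the differentials, which [C1_on] only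
    requires to be linear. *)
Lemma linear_rVR_continuous (W : normedModType R) m
  (L : {linear ('rV[R]_m * R)%type -> W}) : continuous L.
Proof.
have -> : (L : ('rV[R]_m * R)%type -> W) = (fun v => \sum_i v.1 0 i *: L
    (delta_mx 0 i, 0) + v.2 *: L (0, 1)).
  by apply/funext => v; exact: linear_rVR.
move=> v; apply: cvgD.
  apply: (cvg_big add_continuous) => i _; apply: cvgZr_tmp.
  have h1 : x.1 @[x --> v] --> v.1 by case: v => a b; exact: cvg_fst.
  exact: (cvg_comp _ _ h1 (@coord_cvg _ _ v.1 i)).
have h2 : x.2 @[x --> v] --> v.2 by case: v => a b; exact: cvg_snd.
exact: cvgZr_tmp h2.
Qed.

Lemma is_derive_cvg (V W : normedModType R) (f : V -> W) x v l :
  h^-1 *: (f (x + h *: v) - f x) @[h --> (0 : R)^'] --> l -> is_derive x v f l.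
Proof.
move=> H.
have E : (fun h : R => h^-1 *: (f (x + h *: v) - f x)) =
  (fun h : R => h^-1 *: ((f \o shift x) (h *: v) - f x)).
  by apply/funext => h; rewrite /= [x + _]addrC.
rewrite E in H; split; first by apply/cvg_ex; exists l.
exact: (cvg_lim _ H).
Qed.

End frechet.

(** * Outward normal and area element *)

Section normal.
Context {R : realType}.

Lemma dotC m (u v : 'rV[R]_m) : dot u v = dot v u.
Proof. by apply: eq_bigr => i _; rewrite mulrC. Qed.

(** Multiply the transpose of the first matrix by the second: as [n] is orthogonal to the other
    columns, row [i] is [dot v n] at place [i] and 0 elsewhere. Its expansion leaves the Gram matrix
    of the other vectors. *)
Lemma det_orthonormal_row m (i : 'I_m) (a : 'I_m -> 'rV[R]_m) (v n : 'rV[R]_m) :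
  (forall k, k != i -> dot n (a k) = 0) -> dot n n = 1 ->
  wedge (fun k => if k == i then n else a k) *
  wedge (fun k => if k == i then v else a k) =
  dot v n * \det (\matrix_(j < m.-1, l < m.-1) dot (a (lift i j)) (a (lift i l))).
Proof.
move=> nO nn; rewrite /wedge; set A := \matrix_(_, _) _; set B := \matrix_(_,
    _) _.
rewrite -det_tr -det_mulmx.
have E k l : (A^T *m B) k l =
    dot (if k == i then n else a k) (if l == i then v else a l).
  by rewrite !mxE; apply: eq_bigr => j _; rewrite !mxE.
rewrite (expand_det_row _ i) (bigD1 i) //= big1 ?addr0 => [|l li]; last first.
  by rewrite E eqxx (negbTE li) nO ?mul0r.
rewrite E !eqxx dotC; congr (_ * _).
rewrite /cofactor addnn -signr_odd odd_double expr0 mul1r; congr (\det _).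
by apply/matrixP => j l; rewrite mxE mxE E !mxE ![lift i _ == i]eq_sym
  !(negbTE (neq_lift _ _)).
Qed.

(* With A the matrix with n at column i and B the one with v there, A^T A has
   determinant area^2 and A^T B has determinant (v . n) area^2. When det A = 0 the
   determinant of B and the area both vanish. *)
Lemma outward_normal_area m (psi : 'rV[R]_m -> 'rV[R]_m) i s z n v :
  is_outward_normal psi i s z n ->
  dot v n * area_element psi i z =
  (if s then 1 else -1) *
    wedge (fun k => if k == i then v else partial psi z k).
Proof.
set a := partial psi z; case=> nn nO; set w := wedge _ => ws.
have H v' := det_orthonormal_row v' nO nn; rewrite -/w in H.
have := H n; rewrite -/w nn mul1r /area_element -/a => Hn.
rewrite -Hn -expr2 sqrtr_sqr.
have -> : `|w| = (if s then 1 else -1) * w.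
  by case: s ws => /= ws; [rewrite mul1r ger0_norm|rewrite mulN1r ler0_norm].
have := H v; rewrite -Hn mulrCA; set w' := wedge _ => Hw.
have [w0|w0] := eqVneq w 0; last first.
  have -> : w' = dot v n * w.
    by apply: (mulfI w0); rewrite Hw mulrCA.
  by ring.
rewrite w0 !mulr0.
suff -> : w' = 0 by rewrite mulr0.
(* [c] is a linear relation between [n] and the [a k]. Pairing with [n] gives [c 0 i = 0], so the
   relation survives when [n] is replaced by [v]. *)
have /eqP/det0P[c c0 cA] : \det (\matrix_(k, l)
    (if k == i then n else a k) 0 l) = 0.
  by rewrite -w0 -det_tr; congr (\det _); apply/matrixP => k l; rewrite !mxE.
have cE l : \sum_k c 0 k * (if k == i then n else a k) 0 l = 0.
  by have /rowP/(_ l) := cA; rewrite !mxE => E; rewrite -[RHS]E; apply: eq_bigr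
      => k _; rewrite mxE.
have ci : c 0 i = 0.
  transitivity (\sum_k c 0 k * dot n (if k == i then n else a k)).
    rewrite (bigD1 i) //= eqxx nn mulr1 big1 ?addr0 // => k ki.
    by rewrite (negbTE ki) nO ?mulr0.
  under eq_bigr do rewrite mulr_sumr.
  rewrite exchange_big big1 // => l _ /=.
  by under eq_bigr do rewrite mulrCA; rewrite -mulr_sumr cE mulr0.
rewrite /w' /wedge -det_tr; apply/eqP/det0P; exists c => //.
apply/rowP => l; rewrite !mxE -[RHS](cE l); apply: eq_bigr => k _; rewrite !mxE.
by case: eqP => [->|//]; rewrite ci !mul0r.
Qed.

End normal.

(** * Determinants with a special first row or a scaled column *)

Section determinants.
Context {R : realType}.

(* The rows a > 0 contribute expansions along alien cofactors, which vanish. *)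
Lemma det_row0_reduce m (A : 'M[R]_m.+1) (c : 'I_m -> R) r :
  (forall l, A ord0 l = \sum_a c a * A (lift ord0 a) l + (l == ord0)%:R * r) ->
  \det A = r * \det (\matrix_(a, b) A (lift ord0 a) (lift ord0 b)).
Proof.
move=> A0; rewrite (expand_det_row _ ord0).
under eq_bigr do rewrite A0 mulrDl mulr_suml.
rewrite big_split /= exchange_big /= big1 => [|a _]; last first.
  under eq_bigr do rewrite -mulrA.
  rewrite -mulr_sumr.
  have /matrixP/(_ (lift ord0 a) ord0) := mul_mx_adj A.
  rewrite !mxE (_ : (lift ord0 a == ord0) = false) // mulr0n.
  under eq_bigr do rewrite mxE.
  by move=> ->; rewrite mulr0.
rewrite add0r (bigD1 ord0) //= ?eqxx ?mul1r big1 ?addr0 => [|l /negbTE ->];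
    last first.
  by rewrite !mul0r.
congr (_ * _); rewrite /cofactor /= addn0 expr0 mul1r; congr (\det _).
by apply/matrixP => a b; rewrite !mxE.
Qed.

(** One exchange of columns brings the pivot to the corner, so the sign is [-1] whatever [i]; it
    also moves column [0], the time column, to place [i], as in [flux]. *)
Lemma det_row0_delta m (A : 'M[R]_m.+1) (i : 'I_m) :
  (forall l, A ord0 l = (l == lift ord0 i)%:R) ->
  \det A = - \det (\matrix_(a, b)
    if b == i then A (lift ord0 a) ord0 else A (lift ord0 a) (lift ord0 b)).
Proof.
move=> A0; have E : \det A = - \det (xcol ord0 (lift ord0 i) A).
  rewrite -[in RHS](det_tr (xcol _ _ _)) tr_xcol xrowE det_mulmx det_perm
      odd_tperm.
  by rewrite (neq_lift ord0 i) expr1 mulN1r opprK det_tr.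
rewrite E; congr (- _).
rewrite (@det_row0_reduce _ _ (fun=> 0) 1) ?mul1r => [|l].
  congr (\det _); apply/matrixP => a b; rewrite !mxE.
  case: (eqVneq b i) => [->|bi]; first by rewrite tpermR.
  by rewrite tpermD ?neq_lift // (inj_eq lift_inj) eq_sym.
rewrite big1 ?add0r ?mulr1 => [|a _]; last by rewrite mul0r.
by rewrite !mxE A0 -{2}(tpermL ord0 (lift ord0 i)) (inj_eq perm_inj).
Qed.

Lemma det_col_scale m (i : 'I_m) c (X : 'I_m -> R) (Y : 'I_m -> 'I_m -> R) :
  \det (\matrix_(a, b) if b == i then c * X a else Y a b) =
  c * \det (\matrix_(a, b) if b == i then X a else Y a b).
Proof.
rewrite (expand_det_col _ i) [in RHS](expand_det_col _ i) mulr_sumr.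
apply: eq_bigr => a _; rewrite !mxE eqxx -mulrA; congr (_ * (_ * (_ * \det _))).
by apply/matrixP => j l; rewrite !mxE ![lift i _ == i]eq_sym !(negbTE (neq_lift
    _ _)).
Qed.

End determinants.

(** * The motion as a map on a space-time cube *)

Section spacetime.
Context {R : realType}.
Variable m : nat.
Local Notation V := ('rV[R]_m * R)%type.

Definition row_tail (y : 'rV[R]_m.+1) : 'rV[R]_m := \row_j y 0 (lift ord0 j).

Lemma row_tail_continuous : continuous row_tail.
Proof.
move=> y; apply: (@cvg_rV _ _ (nbhs y) _ _ _ (nbhs_filter y)) => j; rewrite mxE.
by under eq_fun do rewrite mxE; exact: coord_cvg.
Qed.

Lemma row_tail_face0 b (x : 'rV[R]_m) : row_tail (face_point ord0 b x) = x.
Proof. by apply/rowP => j; rewrite !mxE liftK. Qed.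

(** Affine in time, so that the domain is the unit cube for every [s], before or after [t]; the map
    still makes sense for [s = t], and is the limit used below. *)
Definition spacetime_point t s (y : 'rV[R]_m.+1) : V :=
  (row_tail y, t + y 0 0 * (s - t)).

Lemma spacetime_pointP (I : set R) t s y : is_interval I -> I t -> I s ->
    closed_cube y ->
  (@closed_cube R m `*` I) (spacetime_point t s y).
Proof.
move=> Iint It Is yc; split=> [j|] /=; first by rewrite mxE.
have /andP[y0 y1] := yc ord0.
have [ts|ts] := leP t s.
  have zts : t <= t + y 0 ord0 * (s - t) <= s by apply/andP; split; nra.
  exact (Iint _ _ It Is _ zts).
have zts : s <= t + y 0 ord0 * (s - t) <= t by apply/andP; split; nra.
exact (Iint _ _ Is It _ zts).
Qed.

Lemma spacetime_point_continuous t s : continuous (spacetime_point t s).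
Proof.
move=> y.
have h : (fun z : 'rV[R]_m.+1 => t + z 0 0 * (s - t)) @ y --> t + y 0 0 * (s - t).
  have hc := @coord_cvg R m.+1 y 0.
  exact (cvgD (cvg_cst t) (cvgM hc (cvg_cst (s - t)))).
exact (cvg_pair (@row_tail_continuous y) h).
Qed.

End spacetime.

Section transport.
Context {R : realType}.
Variables (m : nat) (I : set R).
Local Notation V := ('rV[R]_m * R)%type.
Variables (phi : V -> 'rV[R]_m) (f : V -> R).
Variables (dP : V -> {linear V -> 'rV[R]_m}) (dF : V -> {linear V -> R}).

Local Notation Q := (@closed_cube R m `*` I).
Local Notation E := ([set: 'rV[R]_m] `*` I).

Hypothesis Iint : is_interval I.
Hypothesis dphi : forall x, Q x -> has_diff_in Q phi x (dP x).
Hypothesis cdP : forall v, cont_on Q (fun x => dP x v).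
Hypothesis df : forall x, E x -> has_diff_in E f x (dF x).
Hypothesis cdF : forall v, cont_on E (fun x => dF x v).

Lemma cont_on_coord (U : topologicalType) (D : set U) n (g : U -> 'rV[R]_n) j :
  cont_on D g -> cont_on D (fun x => g x 0 j).
Proof. by move=> cg x Dx; exact: (cvg_comp _ _ (cg x Dx) (@coord_cvg R _ (g x)
    j)). Qed.

Lemma cont_on_pair (U A B : topologicalType) (D : set U) (g : U -> A) (h : U ->
    B) :
  cont_on D g -> cont_on D h -> cont_on D (fun x => (g x, h x)).
Proof. by move=> cg ch x Dx; exact: cvg_pair (cg x Dx) (ch x Dx). Qed.

Definition pullback (p : V) : R := f (phi p, p.2).
Definition pullback_dt (p : V) : R := dF (phi p, p.2) (0, 1).
Definition jacobian_det (p : V) : R := \det (\matrix_(a, b) dP p (delta_mx 0 b,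
    0) 0 a).
(** Up to sign, velocity times normal times area element by [outward_normal_area]. Unlike the
    normal, it is continuous at singular points too. *)
Definition flux (i : 'I_m) (p : V) : R :=
  wedge (fun k => if k == i then dP p (0, 1) else dP p (delta_mx 0 k, 0)).

Lemma cont_phi : cont_on Q phi.
Proof. by move=> x Qx; exact: has_diff_in_cont (dphi Qx)
    (@linear_rVR_continuous _ _ _ _) Qx. Qed.

Lemma cont_f : cont_on E f.
Proof. by move=> x Qx; exact: has_diff_in_cont (df Qx) (@linear_rVR_continuous
    _ _ _ _) Qx. Qed.

Let cont_phi2 : cont_on Q (fun p => (phi p, p.2)).
Proof.
apply: cont_on_pair; first exact: cont_phi.
by apply: continuous_cont_on => -[a b]; exact: cvg_snd.
Qed.

Let phi2E p : Q p -> E (phi p, p.2).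
Proof. by case=> _ pI; split. Qed.

Lemma cont_pullback : cont_on Q pullback.
Proof. exact: (cont_on_comp phi2E cont_phi2 cont_f). Qed.

Let cont_dF v : cont_on Q (fun p => dF (phi p, p.2) v).
Proof. exact: (cont_on_comp phi2E cont_phi2 (@cdF v)). Qed.

Lemma cont_pullback_dt : cont_on Q pullback_dt.
Proof. exact: cont_dF. Qed.

Lemma cont_jacobian_det : cont_on Q jacobian_det.
Proof.
apply: cont_on_det => a b; under eq_fun do rewrite mxE.
exact: cont_on_coord.
Qed.

Lemma cont_flux i : cont_on Q (flux i).
Proof.
apply: cont_on_det => a b; under eq_fun do rewrite mxE.
by case: (b == i); exact: cont_on_coord.
Qed.

Lemma phi_chain (T : Type) (G : set_system T) (k : T -> R) (c : T -> V) v x :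
  Filter G -> Q x -> (\forall h \near G, Q (c h)) -> c h @[h --> G] --> x ->
  k h *: (c h - x) @[h --> G] --> v ->
  k h *: (phi (c h) - phi x) @[h --> G] --> dP x v.
Proof.
move=> FG Qx Qc cx kc.
exact: (@frechet_chain _ _ _ _ _ _ (dP x) _ _ k c v FG (dphi Qx)
    (@linear_rVR_continuous _ _ _ _) Qc cx kc).
Qed.

Lemma pullback_chain (T : Type) (G : set_system T) (k : T -> R) (c : T -> V) v x :
  Filter G -> Q x -> (\forall h \near G, Q (c h)) -> c h @[h --> G] --> x ->
  k h *: (c h - x) @[h --> G] --> v ->
  k h *: (pullback (c h) - pullback x) @[h --> G] --> dF (phi x, x.2) (dP x v,
      v.2).
Proof.
move=> FG Qx Qc cx kc.
have cxw : c h @[h --> G] --> within Q (nbhs x).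
  move=> A; rewrite /within /nbhs /= => xA; have := cx _ xA.
  by rewrite /nbhs /= => cA; move: Qc cA; apply: filterS2 => h Qh; apply.
have c2x : (phi (c h), (c h).2) @[h --> G] --> (phi x, x.2).
  exact: cvg_comp cxw (cont_phi2 Qx).
have k2 : k h *: ((phi (c h), (c h).2) - (phi x, x.2)) @[h --> G] --> (dP x v,
    v.2).
  have h1 := phi_chain FG Qx Qc cx kc.
  have h2 : (k h *: (c h - x)).2 @[h --> G] --> v.2.
    by case: v kc {h1} => v1 v2 kc; exact: cvg_comp kc (@cvg_snd _ _ _ _ _).
  exact: cvg_pair h1 h2.
apply: (@frechet_chain _ _ _ _ _ _ (dF (phi x, x.2)) _ _ k _ _ FG (df (phi2E
    Qx)) (@linear_rVR_continuous _ _ _ _) _ c2x k2).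
by apply: filterS Qc => h; exact: phi2E.
Qed.

Local Notation pt := spacetime_point.

Lemma cont_on_spacetime t s (H : V -> R) : I t -> I s -> cont_on Q H ->
  cont_on (@closed_cube R m.+1) (fun y => H (pt t s y)).
Proof.
move=> It Is cH; apply: (@cont_on_comp _ _ _ _ Q (pt t s) H _ _ cH).
  by move=> y; exact: spacetime_pointP.
by apply: continuous_cont_on; exact: spacetime_point_continuous.
Qed.

Definition spacetime_dir t s (l : 'I_m.+1) : V :=
  if unlift ord0 l is Some b then (delta_mx 0 b, 0) else (0, s - t).

Lemma spacetime_dir0 t s : spacetime_dir t s ord0 = (0, s - t).
Proof. by rewrite /spacetime_dir unlift_none. Qed.

Lemma spacetime_dirS t s b : spacetime_dir t s (lift ord0 b) = (delta_mx 0 b, 0).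
Proof. by rewrite /spacetime_dir liftK. Qed.

Lemma spacetime_point_shift t s y h l :
  pt t s (y + h *: delta_mx 0 l) = pt t s y + h *: spacetime_dir t s l.
Proof.
rewrite /pt /spacetime_dir; congr pair.
  apply/rowP => j; case: unliftP => [b ->|->]; rewrite !mxE ?eqxx /=.
    by rewrite (inj_eq lift_inj).
  by rewrite mulr0.
case: unliftP => [b ->|->]; rewrite !mxE eqxx /= ?mulr0 ?addr0.
  by rewrite [h *: 0]mulr0 addr0.
by rewrite mulr1 mulrDl addrA.
Qed.

(* u_0 = f along the motion, and u_(a+1) = the a-th coordinate of phi; coordinate 0 of
   the cube is the rescaled time, y 0 0 = 0 and 1 being the times t and s. *)
Definition field_along t s (j : 'I_m.+1) (y : 'rV[R]_m.+1) : R :=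
  if unlift ord0 j is Some a then phi (pt t s y) 0 a else pullback (pt t s y).

Definition dfield_along t s (j l : 'I_m.+1) (y : 'rV[R]_m.+1) : R :=
  let p := pt t s y in let v := spacetime_dir t s l in
  if unlift ord0 j is Some a then dP p v 0 a else dF (phi p, p.2) (dP p v, v.2).

Let cont_dpullback (v : V) : cont_on Q (fun p => dF (phi p, p.2) (dP p v, v.2)).
Proof.
(* Continuity of [dF] is given at fixed vectors only, so the moving vector is first expanded on the
   basis. *)
under eq_fun do rewrite linear_rVR /=.
apply: cont_onD; last by apply: cont_onM; [exact: cont_on_cst|exact: cont_dF].
apply: cont_on_sum => i _; apply: cont_onM; last exact: cont_dF.
exact: cont_on_coord.
Qed.

Lemma C1_field_along t s j : I t -> I s ->
  C1_cube (field_along t s j) (dfield_along t s j).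
Proof.
move=> It Is; split.
- rewrite /field_along; case: unliftP => [a _|_].
    apply: (cont_on_spacetime (H := fun p => phi p 0 a)) => //.
    exact: cont_on_coord cont_phi.
  exact: cont_on_spacetime cont_pullback.
- move=> l; rewrite /dfield_along; case: unliftP => [a _|_].
    apply: (cont_on_spacetime (H := fun p => dP p (spacetime_dir t s l) 0 a))
        => //.
    exact: cont_on_coord.
  exact: (cont_on_spacetime It Is (@cont_dpullback (spacetime_dir t s l))).
move=> l y yc /andP[y0 y1]; apply: is_derive_cvg.
have Qy := spacetime_pointP Iint It Is yc.
have Qnear : \forall h \near (0 : R)^', Q (pt t s (y + h *: delta_mx 0 l)).
  have d0 : 0 < Num.min (y 0 l) (1 - y 0 l) by rewrite lt_min y0 subr_gt0.
  near=> h; apply: spacetime_pointP => // i; rewrite !mxE eqxx /=.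
  have : `|h| < Num.min (y 0 l) (1 - y 0 l).
    by near: h; exact: dnbhs0_lt.
  rewrite lt_min !ltr_norml => /andP[/andP[h1 h2] /andP[h3 h4]].
  case: (eqVneq i l) => [->|_]; last by rewrite mulr0 addr0; exact: yc.
  by rewrite mulr1; lra.
have cy : pt t s (y + h *: delta_mx 0 l) @[h --> (0 : R)^'] --> pt t s y.
  have : pt t s (y + h *: delta_mx 0 l) @[h --> nbhs (0 : R)] -->
      pt t s (y + (0 : R) *: delta_mx 0 l).
    apply: (@continuous_comp _ _ _ (fun h : R => y + h *: delta_mx 0 l) (pt t s)).
      exact: rV_shift_continuous.
    exact: spacetime_point_continuous.
  rewrite scale0r addr0; apply: cvg_trans; apply: cvg_app; exact: cvg_within.
have ky : h^-1 *: (pt t s (y + h *: delta_mx 0 l) - pt t s y) @[h --> (0 : R)^']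
    --> spacetime_dir t s l.
  apply: cvg_near_cst; near=> h.
  rewrite spacetime_point_shift addrAC subrr add0r scalerA mulVf ?scale1r //.
  by near: h; exact: nbhs_dnbhs_neq.
rewrite /field_along /dfield_along; case: unliftP => [a _|_].
  have h1 : h^-1 *: (phi (pt t s (y + h *: delta_mx 0 l)) - phi (pt t s y))
      @[h --> (0 : R)^'] --> dP (pt t s y) (spacetime_dir t s l).
    exact: (phi_chain _ Qy Qnear cy ky).
  have := cvg_comp _ _ h1 (@coord_cvg R _ _ a).
  apply: cvg_trans; apply: near_eq_cvg; near=> h.
  by rewrite /= !mxE.
exact: pullback_chain _ Qy Qnear cy ky.
Unshelve. all: by end_near. Qed.

Lemma spacetime_point_face0 t s (b : bool) (x : 'rV[R]_m) :
  pt t s (face_point ord0 b x) = (x, if b then s else t).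
Proof.
rewrite /pt row_tail_face0 mxE unlift_none; congr pair.
by case: b; rewrite ?mul1r ?mul0r ?addr0 // addrC subrK.
Qed.

(** [stokes_det] applied to [field_along]: the two faces orthogonal to time give the increment, and
    the lateral ones come out with the factor [- (s - t)], hence their change of side. *)
Lemma transport_increment t s : I t -> I s ->
  int_cube (fun x => pullback (x, s) * jacobian_det (x, s)) -
  int_cube (fun x => pullback (x, t) * jacobian_det (x, t)) =
  (s - t) * (int_cube (fun y => pullback_dt (pt t s y) * jacobian_det (pt t s
      y)) +
    \sum_i boundary (lift ord0 i) (fun y => pullback (pt t s y) * flux i (pt t
        s y))).
Proof.
move=> It Is.
have jacE (y : 'rV[R]_m.+1) : \det (\matrix_(a, b)
    dfield_along t s (lift ord0 a) (lift ord0 b) y) = jacobian_det (pt t s y).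
  by congr (\det _); apply/matrixP => a b; rewrite !mxE /dfield_along liftK
      spacetime_dirS.
have := stokes_det (fun j => C1_field_along j It Is).
rewrite big_ord_recl.
set S0 := boundary ord0 _.
have -> : S0 = int_cube (fun x => pullback (x, s) * jacobian_det (x, s)) -
  int_cube (fun x => pullback (x, t) * jacobian_det (x, t)).
  have -> : S0 = boundary ord0 (fun y => pullback (pt t s y) * jacobian_det (pt
      t s y)).
    apply: eq_boundary => y _; rewrite {1}/field_along unlift_none; congr (_ * _).
    rewrite (@det_row0_reduce _ _ _ (fun=> 0) 1) ?mul1r => [|l].
      rewrite -jacE; congr (\det _); apply/matrixP => a b; rewrite !mxE.
      by rewrite eq_sym (negbTE (neq_lift _ _)).
    by rewrite big1 ?add0r ?mulr1 ?mxE // => a _; rewrite mul0r.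
  by congr (_ - _); apply: eq_int_cube => x _; rewrite spacetime_point_face0.
(* By the chain rule, row [0] is the combination of the rows of [phi] with coefficients the space
   derivatives of [f], plus [(s - t) * pullback_dt] in the time column; only the latter counts in
   the determinant. *)
have -> : int_cube (fun y => \det (\matrix_(j, l) dfield_along t s j l y)) =
  (s - t) * int_cube (fun y => pullback_dt (pt t s y) * jacobian_det (pt t s y)).
  rewrite -int_cubeZ_cont; last first.
    apply: cont_onM; apply: cont_on_spacetime => //; [exact:
        cont_pullback_dt|exact: cont_jacobian_det].
  apply: eq_int_cube => y _.
  rewrite (@det_row0_reduce _ _ _ (fun a => dF (phi (pt t s y), (pt t s y).2)
      (delta_mx 0 a, 0))
     ((s - t) * pullback_dt (pt t s y))).
    rewrite mulrA -jacE; congr (_ * \det _).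
    by apply/matrixP => a b; rewrite !mxE.
  move=> l; rewrite mxE {1}/dfield_along unlift_none linear_rVR /=; congr (_ + _).
    apply: eq_bigr => a _; rewrite mxE /dfield_along liftK.
    by rewrite [LHS]mulrC.
  rewrite -/(pullback_dt _); case: (unliftP ord0 l) => [b ->|->].
    by rewrite spacetime_dirS eq_sym (negbTE (neq_lift _ _)) /= scale0r mul0r.
  by rewrite spacetime_dir0 /= mul1r.
(* The time column is the velocity scaled by [s - t], and exchanging it with column [lift ord0 i]
   gives the minus sign. *)
have fluxE i : boundary (lift ord0 i) (fun y => field_along t s ord0 y *
    \det (\matrix_(j, l) if j == ord0 then (l == lift ord0 i)%:R
       else dfield_along t s j l y)) =
   - (s - t) * boundary (lift ord0 i) (fun y => pullback (pt t s y) * flux i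
       (pt t s y)).
  rewrite -boundaryZ; last first.
    apply: cont_onM; apply: cont_on_spacetime => //; [exact:
        cont_pullback|exact: cont_flux].
  apply: eq_boundary => y _; rewrite {1}/field_along unlift_none.
  rewrite (@det_row0_delta _ _ _ i) => [|l]; last by rewrite mxE.
  rewrite [RHS]mulrCA; congr (_ * _); rewrite mulNr; congr (- _).
  rewrite /flux /wedge.
  transitivity (\det (\matrix_(a, b) if b == i then
     (s - t) * dP (pt t s y) (0, 1) 0 a else dP (pt t s y) (delta_mx 0 b, 0) 0
         a)).
    congr (\det _); apply/matrixP => a b; rewrite !mxE /dfield_along liftK.
    rewrite eq_sym (negbTE (neq_lift _ _)) spacetime_dir0 spacetime_dirS; case:
        ifP => // _.
    have -> : (0 : 'rV[R]_m, s - t) = (s - t) *: (0, 1).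
      by congr pair => /=; rewrite ?scaler0 // [RHS]mulr1.
    by rewrite linearZ mxE.
  rewrite det_col_scale; congr (_ * \det _); apply/matrixP => a b; rewrite !mxE.
  by case: ifP.
under eq_bigr do rewrite fluxE.
rewrite -mulr_sumr => E; rewrite mulrDr -E; ring.
Qed.

End transport.

(** * Passage to the limit *)

Section spacetime_limit.
Context {R : realType}.
Local Notation pt := spacetime_point.

Lemma cont_on_sub (U W : topologicalType) (A B : set U) (g : U -> W) :
  A `<=` B -> cont_on B g -> cont_on A g.
Proof.
move=> AB cg x Ax; apply: cvg_trans (cg x (AB x Ax)); apply: cvg_app.
by move=> S; rewrite /within /nbhs /=; apply: filterS => y By Ay; apply: By;
    exact: AB.
Qed.

(** [I] may be open or unbounded; the uniform bound comes from the compact product of the cube with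
    [[a, b]], which contains [t] and all [s_ k]. *)
Lemma spacetime_bounded_cvg m (I : set R) (H : 'rV[R]_m * R -> R) t a b
    (s_ : nat -> R) :
  is_interval I -> cont_on (@closed_cube R m `*` I) H -> I a -> I b ->
  a <= t <= b -> (forall k, a <= s_ k <= b) -> s_ k @[k --> \oo] --> t ->
  bounded_cvg (@closed_cube R m.+1) (fun k y => H (pt t (s_ k) y))
    (fun y => H (pt t t y)).
Proof.
move=> Iint cH Ia Ib tab sab st.
pose J : set R := `[a, b]%classic.
have JI : J `<=` I by move=> z zab; exact: (Iint _ _ Ia Ib z zab).
have Jint : is_interval J by exact: interval_is_interval.
have Jt : J t by exact: tab.
have Js k : J (s_ k) by exact: sab.
have cHJ : cont_on (@closed_cube R m `*` J) H.
  by apply: cont_on_sub cH => -[x s] [? ?]; split=> //; exact: JI.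
have cQ : compact (@closed_cube R m `*` J).
  by apply: compact_setX; [exact: compact_closed_cube|exact: segment_compact].
have [M HM] := compact_cont_on_bounded cQ cHJ.
split; first by exists M => k y yc; apply: HM; exact: spacetime_pointP.
move=> y yc.
have Qt := spacetime_pointP Jint Jt Jt yc.
have c1 : t + y 0 0 * (s_ k - t) @[k --> \oo] --> t + y 0 0 * (t - t).
  apply: cvgD; first exact: cvg_cst.
  apply: cvgM; first exact: cvg_cst.
  by apply: cvgB => //; exact: cvg_cst.
have c2 : pt t (s_ k) y @[k --> \oo] --> pt t t y.
  exact (cvg_pair (cvg_cst (row_tail y)) c1).
have c3 : pt t (s_ k) y @[k --> \oo] --> within (@closed_cube R m `*` J) (nbhs
    (pt t t y)).
  move=> A; rewrite /within /nbhs /= => /c2; rewrite /nbhs /=.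
  by apply: filterS => k; apply; exact: spacetime_pointP.
exact: cvg_comp c3 (cHJ _ Qt).
Qed.

(** Coordinate [0] is absent from the integrand and ranges over an interval of length 1. Space-time
    integrals take this form in the limit [s = t]. *)
Lemma int_cube_row_tail m (h : 'rV[R]_m -> R) : cont_on (@closed_cube R m) h ->
  int_cube (fun y => h (row_tail y)) = int_cube h.
Proof.
move=> ch.
have := @int_cube_cons R m (fun=> 1) h (measurable_cst _) _
  (cont_on_cube_measurable ch) (cont_on_cube_bounded ch).
rewrite Rintegral_cst; last exact: measurable_itv.
rewrite /= lebesgue_measure_itv /= lte_fin ltr01 oppr0 adde0 /= !mul1r => <-.
  by apply: eq_int_cube => y _; rewrite mul1r.
by exists 1 => a _; rewrite normr1.
Qed.

Variables (m : nat) (I : set R) (t a b : R) (s_ : nat -> R).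
Hypotheses (Iint : is_interval I) (Ia : I a) (Ib : I b) (tab : a <= t <= b).
Hypotheses (sab : forall k, a <= s_ k <= b) (st : s_ k @[k --> \oo] --> t).

Let It : I t. Proof. exact: (Iint Ia Ib). Qed.
Let Is k : I (s_ k). Proof. exact: (Iint Ia Ib). Qed.

Lemma cont_on_slice n (H : 'rV[R]_n * R -> R) r :
  cont_on (@closed_cube R n `*` I) H -> I r ->
  cont_on (@closed_cube R n) (fun x => H (x, r)).
Proof.
move=> cH Ir; apply: (@cont_on_comp _ _ _ _ (@closed_cube R n `*` I) (fun x =>
    (x, r)) H _ _ cH).
  by move=> x xc.
apply: cont_on_pair; last exact: cont_on_cst.
by move=> x xc; exact: cvg_within.
Qed.

Let ptt n (y : 'rV[R]_n.+1) : pt t t y = (row_tail y, t).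
Proof. by rewrite /spacetime_point subrr mulr0 addr0. Qed.

Lemma int_cube_spacetime_cvg n (H : 'rV[R]_n * R -> R) :
  cont_on (@closed_cube R n `*` I) H ->
  int_cube (fun y => H (pt t (s_ k) y)) @[k --> \oo] -->
  int_cube (fun x => H (x, t)).
Proof.
move=> cH; rewrite -(int_cube_row_tail (cont_on_slice cH It)).
rewrite [X in _ --> X](_ : _ = int_cube (fun y => H (pt t t y))); last first.
  by apply: eq_int_cube => y _; rewrite ptt.
apply: int_cube_cvg.
  by move=> k; apply: cont_on_cube_measurable; exact: cont_on_spacetime cH.
exact: bounded_cvg_open (spacetime_bounded_cvg Iint cH Ia Ib tab sab st).
Qed.

Lemma row_tail_faceS n (i : 'I_n.+1) c (y : 'rV[R]_n.+1) :
  row_tail (face_point (lift ord0 i) c y) = face_point i c (row_tail y).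
Proof.
apply/rowP => k; rewrite !mxE.
case: (unliftP i k) => [j ->|->]; last by rewrite unlift_none.
have -> : lift ord0 (lift i j) = lift (lift ord0 i) (lift ord0 j).
  by apply/val_inj; rewrite /= /bump /= !add1n ltnS addnS.
by rewrite liftK mxE.
Qed.

Lemma boundary_spacetime_cvg (H : 'rV[R]_m.+1 * R -> R) i :
  cont_on (@closed_cube R m.+1 `*` I) H ->
  boundary (lift ord0 i) (fun y => H (pt t (s_ k) y)) @[k --> \oo] -->
  int_cube (fun y : 'rV[R]_m => H (face_point i true y, t)) -
  int_cube (fun y : 'rV[R]_m => H (face_point i false y, t)).
Proof.
move=> cH.
have fE c : int_cube (fun y : 'rV[R]_m => H (face_point i c y, t)) =
    int_cube (fun y : 'rV[R]_m.+1 => H (pt t t (face_point (lift ord0 i) c y))).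
  have cf : cont_on (@closed_cube R m) (fun y => H (face_point i c y, t)).
    exact: (cont_on_face (cont_on_slice cH It)).
  rewrite -(int_cube_row_tail cf).
  by apply: eq_int_cube => y _; rewrite ptt row_tail_faceS.
rewrite !fE; apply: cvgB; apply: int_cube_cvg.
1,3: move=> k; apply: cont_on_cube_measurable.
1,2: exact: (cont_on_face (cont_on_spacetime Iint It (Is k) cH)).
all: apply: bounded_cvg_open; apply: (@bounded_cvg_face R _ (lift ord0 i) _
    (fun k y => H (pt t (s_ k) y)) (fun y => H (pt t t y))).
all: exact: (spacetime_bounded_cvg Iint cH Ia Ib tab sab st).
Qed.

End spacetime_limit.

(** * Points of an interval near one of its elements *)

Section interval_filter.
Context {R : realType}.
Variables (I : set R) (t : R).
Hypotheses (Iint : is_interval I) (It : I t).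

(** By convexity [I] contains the segment from [t] to a second point [s]. Properness is what makes
    the [lim] in [deriv_in] return the derivative. *)
Lemma within_dnbhs_proper s : I s -> s != t -> ProperFilter (within I t^').
Proof.
move=> Is st; apply: Build_ProperFilter_ex => P.
rewrite /within /= /dnbhs /within /= => /nbhs_ballP[e /= e0 eP].
(* [1 / 2] keeps the point on the segment, the other bound keeps it within [e] of [t]. *)
pose r := Num.min (1 / 2) (e / 2 / `|s - t|).
have st0 : 0 < `|s - t| by rewrite normr_gt0 subr_eq0.
have r0 : 0 < r by rewrite /r lt_min !divr_gt0.
have r1 : r <= 1 / 2 by rewrite /r ge_min lexx.
have re : r * `|s - t| <= e / 2.
  by rewrite -ler_pdivlMr // /r ge_min lexx orbT.
have Ir : I (t + r * (s - t)).
  have [ts|ts] := leP t s.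
    by apply: (Iint It Is); apply/andP; split; nra.
  by apply: (Iint Is It); apply/andP; split; nra.
exists (t + r * (s - t)); apply: eP => //.
  rewrite /ball /= opprD addrA subrr add0r normrN normrM gtr0_norm //.
  by rewrite (le_lt_trans re) // gtr_pMr // invf_lt1 ?ltr1n.
by rewrite -[X in _ != X]addr0 (inj_eq (addrI t)) mulf_neq0 ?subr_eq0 // gt_eqF.
Qed.

(** On a side where [I] continues beyond [t] the bound is a further point of [I]; on a side where
    [t] is an endpoint it is [t] itself. *)
Lemma within_interval_bounds : exists a b, [/\ I a, I b, a <= t <= b &
  \forall s \near within I t^', a <= s <= b].
Proof.
have [a [Ia at_ aP]] : exists a, [/\ I a, a <= t & \forall s \near within I
    t^', a <= s].
  have [[a Ia at_]|noa] := pselect (exists2 a, I a & a < t).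
    exists a; split=> //; first exact: ltW.
    rewrite near_withinE; apply: nbhs_dnbhs; near=> s => _.
    by rewrite ltW //; near: s; exact: lt_nbhsr.
  exists t; split=> //; rewrite near_withinE; near=> s => Is.
  by rewrite leNgt; apply/negP => st; apply: noa; exists s.
have [b [Ib tb bP]] : exists b, [/\ I b, t <= b & \forall s \near within I t^',
    s <= b].
  have [[b Ib tb]|nob] := pselect (exists2 b, I b & t < b).
    exists b; split=> //; first exact: ltW.
    rewrite near_withinE; apply: nbhs_dnbhs; near=> s => _.
    by rewrite ltW //; near: s; exact: lt_nbhsl.
  exists t; split=> //; rewrite near_withinE; near=> s => Is.
  by rewrite leNgt; apply/negP => st; apply: nob; exists s.
exists a, b; split=> //; first by rewrite at_ tb.
by apply: filterS2 aP bP => s -> ->.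
Unshelve. all: by end_near. Qed.

(** Dominated convergence is for sequences. If the limit failed, points at distance less than
    1/(k+1) from [t] where [g] is more than [e] away from [L] would form a forbidden sequence. *)
Lemma cvg_within_seq (g : R -> R) (L a b : R) :
  (\forall s \near within I t^', a <= s <= b) ->
  (forall s_ : nat -> R, (forall k, [/\ I (s_ k), s_ k != t & a <= s_ k <= b]) ->
     s_ k @[k --> \oo] --> t -> g (s_ k) @[k --> \oo] --> L) ->
  g s @[s --> within I t^'] --> L.
Proof.
move=> nab gs; apply/cvgrPdist_le => e e0; apply: contrapT => nH.
have ex (k : nat) : exists s, [/\ I s, s != t, a <= s <= b, `|t - s| <
    k.+1%:R^-1 &
    ~ (`|L - g s| <= e)].
  apply: contrapT => nex; apply: nH; near=> s.
  have sI : I s by near: s; exact: withinT.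
  apply: contrapT => Lgs; apply: nex; exists s; split=> //.
  - near: s; rewrite near_withinE.
    by apply: filterS (nbhs_dnbhs_neq t) => z zt _.
  - by near: s.
  - near: s; rewrite near_withinE; apply: nbhs_dnbhs.
    have k0 : 0 < k.+1%:R^-1 :> R by rewrite invr_gt0.
    by apply: filterS (@nbhsx_ballx _ _ t _ k0) => z zt _.
have [s_ sP] := choice ex.
have st : s_ k @[k --> \oo] --> t.
  apply/cvgrPdist_lt => d d0; near=> k.
  have [_ _ _ + _] := sP k; move/lt_trans; apply; near: k.
  exact: (near_infty_natSinv_lt (PosNum d0)).
have /gs/(_ st) : forall k, [/\ I (s_ k), s_ k != t & a <= s_ k <= b].
  by move=> k; have [] := sP k.
move/cvgrPdist_le => /(_ e e0)[N _ /(_ N (leqnn N))] /=.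
by have [_ _ _ _] := sP N.
Unshelve. all: by end_near. Qed.

End interval_filter.

(** * The derivatives of the statement in terms of the differentials *)

Section derivatives.
Context {R : realType}.
Variables (m : nat) (I : set R).
Local Notation V := ('rV[R]_m * R)%type.
Variables (phi : V -> 'rV[R]_m) (f : V -> R).
Variables (dP : V -> {linear V -> 'rV[R]_m}) (dF : V -> {linear V -> R}).

Local Notation Q := (@closed_cube R m `*` I).
Local Notation E := ([set: 'rV[R]_m] `*` I).

Hypothesis dphi : forall x, Q x -> has_diff_in Q phi x (dP x).
Hypothesis df : forall x, E x -> has_diff_in E f x (dF x).

Lemma time_increment_cvg (F : set_system R) (x : 'rV[R]_m) t : Filter F ->
  F `=>` t^' -> (s - t)^-1 *: ((x, s) - (x, t)) @[s --> F] --> ((0, 1) : V).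
Proof.
move=> FF Ft; apply: cvg_near_cst.
have H : \forall s \near F, s != t := Ft _ (nbhs_dnbhs_neq t).
apply: filterS H => s st.
have -> : (x, s) - (x, t) = (s - t) *: ((0, 1) : V).
  by congr pair => /=; rewrite ?subrr ?scaler0 // [RHS]mulr1.
by rewrite scalerA mulVf ?scale1r // subr_eq0.
Qed.

Lemma time_cvg (F : set_system R) (x : 'rV[R]_m) t : Filter F ->
  F `=>` t^' -> (x, s) @[s --> F] --> ((x, t) : V).
Proof.
move=> FF Ft.
have h : (fun s : R => s) @ F --> t by move=> A /nbhs_dnbhs; exact: Ft.
exact (cvg_pair (cvg_cst x) h).
Qed.

Lemma within_dnbhs_le t : within I t^' `=>` t^'.
Proof. exact: cvg_within. Qed.

Lemma deriv_in_phi z t : closed_cube z -> I t -> ProperFilter (within I t^') ->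
  deriv_in I (fun s => phi (z, s)) t = dP (z, t) (0, 1).
Proof.
move=> zc It PF; have FF : Filter (within I t^') by exact: PF.
apply: (cvg_lim (@norm_hausdorff _ _)).
have Qz : Q (z, t) by split.
have Qs : \forall s \near within I t^', Q (z, s).
  by rewrite near_withinE; near=> s => Is; split.
have H := (@phi_chain R m I phi dP dphi R (within I t^') (fun s => (s - t)^-1)
  (fun s => (z, s)) (0, 1) (z, t) FF Qz Qs (@time_cvg _ _ _ FF
      (@within_dnbhs_le t))
  (@time_increment_cvg _ _ _ FF (@within_dnbhs_le t))).
exact: H.
Unshelve. all: by end_near. Qed.

Lemma deriv_in_f p t : I t -> ProperFilter (within I t^') ->
  deriv_in I (fun s => f (p, s)) t = dF (p, t) (0, 1).
Proof.
move=> It PF; have FF : Filter (within I t^') by exact: PF.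
apply: (cvg_lim (@norm_hausdorff _ _)).
have Ep : E (p, t) by split.
have Es : \forall s \near within I t^', E (p, s).
  by rewrite near_withinE; near=> s => Is; split.
exact: (@frechet_chain _ _ _ _ _ _ (dF (p, t)) _ _ (fun s => (s - t)^-1)
  (fun s => (p, s)) _ FF (df Ep) (@linear_rVR_continuous _ _ _ _) Es
  (@time_cvg _ _ _ FF (@within_dnbhs_le t))
  (@time_increment_cvg _ _ _ FF (@within_dnbhs_le t))).
Unshelve. all: by end_near. Qed.

(** Only coordinate [k] has to be interior, so the derivatives tangent to an open face are
    covered. *)
Lemma partial_phi z t k : closed_cube z -> I t -> 0 < z 0 k < 1 ->
  partial (fun x => phi (x, t)) z k = dP (z, t) (delta_mx 0 k, 0).
Proof.
move=> zc It /andP[z0 z1]; apply: derive_val.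
apply: is_derive_cvg.
have Qz : Q (z, t) by split.
apply: (@phi_chain R m I phi dP dphi R (0 : R)^' (fun h => h^-1)
  (fun h => (z + h *: delta_mx 0 k, t)) _ (z, t) _ Qz).
- have d0 : 0 < Num.min (z 0 k) (1 - z 0 k) by rewrite lt_min z0 subr_gt0.
  near=> h; split=> //= i; rewrite !mxE eqxx /=.
  have : `|h| < Num.min (z 0 k) (1 - z 0 k).
    by near: h; exact: dnbhs0_lt.
  rewrite lt_min !ltr_norml => /andP[/andP[h1 h2] /andP[h3 h4]].
  case: (eqVneq i k) => [->|_]; last by rewrite mulr0 addr0; exact: zc.
  by rewrite mulr1; lra.
- have h1 : (fun h : R => z + h *: delta_mx 0 k) @ (0 : R)^' --> z.
    have : (fun h : R => z + h *: delta_mx 0 k) @ nbhs (0 : R) -->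
        z + (0 : R) *: delta_mx 0 k by exact: rV_shift_continuous.
    by rewrite scale0r addr0; apply: cvg_trans; apply: cvg_app; exact: cvg_within.
  exact (cvg_pair h1 (cvg_cst t)).
- apply: cvg_near_cst; near=> h.
  have -> : (z + h *: delta_mx 0 k, t) - (z, t) = h *: ((delta_mx 0 k, 0) : V).
    congr pair => /=; first by rewrite addrAC subrr add0r.
    by rewrite subrr [RHS]mulr0.
  rewrite scalerA mulVf ?scale1r //.
  by near: h; exact: nbhs_dnbhs_neq.
Unshelve. all: by end_near. Qed.

(** At an interior point the differential relative to [Q] restricts to an ordinary differential in
    space, equal to ['d] by uniqueness. The two matrices are transposes of each other. *)
Lemma Jdet_jacobian_det x s : open_cube x -> I s ->
  Jdet (fun x' => phi (x', s)) x = jacobian_det dP (x, s).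
Proof.
move=> xo Is; have xc := open_closed_cube xo.
pose g x' := phi (x', s).
pose A := \matrix_(i, j) dP (x, s) (delta_mx 0 i, 0) 0 j.
have dA v : dP (x, s) (v, 0) = v *m A.
  rewrite linear_rVR /= scale0r addr0; apply/rowP => j; rewrite !mxE summxE.
  by apply: eq_bigr => i _; rewrite !mxE.
have cA : continuous (mulmxr A : 'rV[R]_m -> 'rV[R]_m).
  have -> : (mulmxr A : 'rV[R]_m -> 'rV[R]_m) = (fun v => dP (x, s) (v, 0)).
    by apply/funext => v; rewrite dA.
  move=> v; apply: (@cvg_comp _ _ _ (fun v : 'rV[R]_m => (v, 0) : V) (dP (x,
      s)) _ (nbhs ((v, 0) : V))).
    exact (cvg_pair (@cvg_id _ (nbhs v)) (cvg_cst (0 : R))).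
  exact: linear_rVR_continuous.
have dg : 'd g x = mulmxr A :> ('rV[R]_m -> 'rV[R]_m).
  apply: diff_unique => //; apply/eqaddoP => e e0.
  have Qx : Q (x, s) by split.
  have := dphi Qx e0; rewrite near_withinE => H.
  have cx : ((h + x, s) : V) @[h --> (0 : 'rV[R]_m)] --> ((x, s) : V).
    have h1 : (fun h : 'rV[R]_m => h + x) @ (0 : 'rV[R]_m) --> 0 + x.
      exact (cvgD (@cvg_id _ (nbhs (0 : 'rV[R]_m))) (cvg_cst x)).
    rewrite add0r in h1.
    exact (cvg_pair h1 (cvg_cst s)).
  have oh : \forall h \near (0 : 'rV[R]_m), forall i, 0 <= (h + x) 0 i <= 1.
    apply: (@filter_forall _ _ (fun i (h : 'rV[R]_m) => 0 <= (h + x) 0 i <= 1)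
        (nbhs (0 : 'rV[R]_m))) => i; have /andP[x0 x1] := xo i.
    have d0 : 0 < Num.min (x 0 i) (1 - x 0 i) by rewrite lt_min x0 subr_gt0.
    have h0 := @coord_cvg R _ 0 i; rewrite mxE in h0.
    move/cvgr0Pnorm_lt : h0 => /(_ _ d0); apply: filterS => h.
    by rewrite mxE lt_min !ltr_norml => /andP[/andP[h1 h2] /andP[h3 h4]]; lra.
  have := cx _ H; rewrite /nbhs /=; move: oh; apply: filterS2 => h oh Hh.
  have := Hh (conj oh Is).
  have -> : (h + x, s) - (x, s) = ((h, 0) : V).
    by congr pair => /=; rewrite ?addrK // subrr.
  rewrite dA => K.
  have hn : `|(h, 0) : V| = `|h| by rewrite prod_normE /= normr0 max_l.
  by rewrite hn in K; move: K; rewrite -addrA -opprD.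
rewrite /Jdet /jacobian_det -det_tr; congr (\det _); apply/matrixP => a b;
    rewrite !mxE dg /=.
by rewrite -rowE !mxE.
Qed.

End derivatives.

Section flux_formula.
Context {R : realType}.
Variables (m : nat) (I : set R).
Local Notation V := ('rV[R]_m.+1 * R)%type.
Variables (phi : V -> 'rV[R]_m.+1) (f : V -> R).
Variables (dP : V -> {linear V -> 'rV[R]_m.+1}).
Local Notation Q := (@closed_cube R m.+1 `*` I).
Hypothesis dphi : forall x, Q x -> has_diff_in Q phi x (dP x).

(** [outward_normal_area] holds pointwise, singular points included; its sign [-1] on the face where
    coordinate [i] is 0 becomes the subtraction. *)
Lemma oint_flux t : I t -> ProperFilter (within I t^') ->
  (forall i, cont_on Q (fun p => pullback phi f p * flux dP i p)) ->
  oint (fun z => phi (z, t)) (fun z n =>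
    f (phi (z, t), t) * dot (deriv_in I (fun s => phi (z, s)) t) n) =
  \sum_(i < m.+1) (int_cube (fun y : 'rV[R]_m =>
      pullback phi f (face_point i true y, t) * flux dP i (face_point i true y,
          t)) -
    int_cube (fun y : 'rV[R]_m =>
      pullback phi f (face_point i false y, t) * flux dP i (face_point i false
          y, t))).
Proof.
move=> It PF cF; apply: eq_bigr => i _.
have E (c : bool) (y : 'rV[R]_m) : open_cube y ->
   f (phi (face_point i c y, t), t) *
     dot (deriv_in I (fun s => phi (face_point i c y, s)) t)
       (outward_normal (fun z => phi (z, t)) i c (face_point i c y)) *
     area_element (fun z => phi (z, t)) i (face_point i c y) =
   (if c then 1 else -1) *
     (pullback phi f (face_point i c y, t) * flux dP i (face_point i c y, t)).
  move=> yo; have zc := face_point_closed i c (open_closed_cube yo).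
  rewrite -mulrA (outward_normal_area _ (outward_normalP _ i c _)) mulrCA.
  congr (_ * (_ * _)); rewrite /flux; congr wedge; apply/funext => k.
  case: eqVneq => [_|ki]; first exact: deriv_in_phi.
  apply: (partial_phi dphi zc It); rewrite mxE.
  by case: unliftP ki => [j -> _|->]; [exact: yo|rewrite eqxx].
rewrite big_bool /=; congr (_ + _).
  by apply: eq_int_cube => y yo; rewrite E // mul1r.
rewrite -mulN1r -int_cubeZ_cont; last first.
  exact: (cont_on_face (cont_on_slice (cF i) It)).
by apply: eq_int_cube => y yo; rewrite E.
Qed.

End flux_formula.

Unset Implicit Arguments.

Theorem theorem3p16 (R : realType) (m : nat) (I : set R)
    (phi : 'rV[R]_m * R -> 'rV[R]_m) (f : 'rV[R]_m * R -> R) :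
  (2 <= m)%N ->
  is_interval I ->
  C1_on (closed_cube (n:=m) `*` I) phi ->
  C1_on ([set: 'rV[R]_m] `*` I) f ->
  forall t : R, I t ->
  is_deriv_in I
    (fun s => int_cube (fun x : 'rV[R]_m =>
       f (phi (x, s), s) * Jdet (fun x' => phi (x', s)) x)) t
    (int_cube (fun x : 'rV[R]_m =>
       deriv_in I (fun s => f (phi (x, t), s)) t * Jdet (fun x' => phi (x', t)) x)
     + oint (fun z => phi (z, t)) (fun z n =>
         f (phi (z, t), t) * dot (deriv_in I (fun s => phi (z, s)) t) n)).
Proof.
case: m phi f => [//|m] phi f _ Iint [dP [dphi cdP']] [dF [df cdF']] t It.
have cdP v : cont_on (@closed_cube R m.+1 `*` I) (fun x => dP x v).
  by apply/subspace_continuousP; exact: cdP'.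
have cdF v : cont_on ([set: 'rV[R]_m.+1] `*` I) (fun x => dF x v).
  by apply/subspace_continuousP; exact: cdF'.
rewrite /is_deriv_in.
(* If [I] is reduced to [t], the filter [within I t^'] contains the empty set and every limit
   holds. *)
have [[s0 [Is0 s0t]]|nos] := pselect (exists s, I s /\ s != t); last first.
  move=> A _; rewrite /nbhs /= /within /=; apply: filterS (nbhs_dnbhs_neq t).
  by move=> s st Is; exfalso; apply: nos; exists s.
have PF := within_dnbhs_proper Iint It Is0 s0t.
pose ftj p := pullback phi f p * jacobian_det dP p.
have FE s : I s -> int_cube (fun x => f (phi (x, s), s) * Jdet (fun x' => phi
    (x', s)) x) =
    int_cube (fun x => ftj (x, s)).
  by move=> Is; apply: eq_int_cube => x xo; rewrite (Jdet_jacobian_det dphi xo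
      Is).
have dFE : int_cube (fun x : 'rV[R]_m.+1 => deriv_in I (fun s => f (phi (x, t),
    s)) t *
      Jdet (fun x' => phi (x', t)) x) = int_cube (fun x => pullback_dt phi dF
          (x, t) * jacobian_det dP (x, t)).
  apply: eq_int_cube => x xo; rewrite (Jdet_jacobian_det dphi xo It); congr (_
      * _).
  exact: (deriv_in_f df).
have cpb := cont_pullback dphi df.
have cpbt := cont_pullback_dt dphi cdF.
have cjac := cont_jacobian_det cdP.
have cflux (i : 'I_m.+1) : cont_on (@closed_cube R m.+1 `*` I) (flux dP i).
  exact: cont_flux.
rewrite [X in _ --> X + _]dFE.
rewrite [X in _ --> _ + X](oint_flux dphi It PF); last first.
  by move=> i; exact: cont_onM.
have [a [b [Ia Ib tab nab]]] := within_interval_bounds It.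
apply: (cvg_within_seq nab) => s_ sP st.
have sI k : I (s_ k) by have [] := sP k.
have sab k : a <= s_ k <= b by have [] := sP k.
pose X s := int_cube (fun y => pullback_dt phi dF (spacetime_point t s y) *
    jacobian_det dP (spacetime_point t s y)) +
    \sum_i boundary (lift ord0 i) (fun y => pullback phi f (spacetime_point t s
        y) * flux dP i (spacetime_point t s y)).
have E k : (s_ k - t)^-1 *: (int_cube (fun x => f (phi (x, s_ k), s_ k) * Jdet
    (fun x' => phi (x', s_ k)) x) -
   int_cube (fun x => f (phi (x, t), t) * Jdet (fun x' => phi (x', t)) x)) = X
       (s_ k).
  have TI := transport_increment Iint dphi cdP df cdF It (sI k).
  transitivity ((s_ k - t)^-1 *: ((s_ k - t) * X (s_ k))).
    congr (_ *: _); refine (etrans _ TI).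
    by congr (_ - _); [exact: FE (sI k)|exact: FE It].
  by apply: mulKf; rewrite subr_eq0; have [] := sP k.
rewrite (funext E); apply: cvgD.
  apply: (@int_cube_spacetime_cvg _ I _ _ _ _ Iint Ia Ib tab sab st _ (fun p =>
      pullback_dt phi dF p * jacobian_det dP p)).
  exact: cont_onM.
apply: (cvg_big add_continuous) => i _.
apply: (@boundary_spacetime_cvg _ _ I _ _ _ _ Iint Ia Ib tab sab st (fun p =>
    pullback phi f p * flux dP i p)).
exact: cont_onM.
Qed.
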